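(* Let $\nu$ be an admissible profile with $\alpha_{\min}:=\inf\{\alpha:\nu(\alpha)\ge0\}\in\mathbb{R}$, let $\nu'$ be its dual profile, let $(\varepsilon_m)$ be a sequence of positive reals decreasing to $0$, and let $\nu'_m(\alpha'):=\nu'(\alpha'-\varepsilon_m)$. Let $$p_0 := \min\Big(1,\ \inf_{\alpha:\,0\le\nu(\alpha)<1}\underline{\partial}^+\nu(\alpha)\Big).$$ If $p_0=1$, then topologically $(S^\nu)'_b=\operatorname{ind}_m S^{\nu'_m}$; that is, under the identification of $(S^\nu)'$ with the union $\bigcup_m S^{\nu'_m}$, the strong topology on $(S^\nu)'$ (uniform convergence on the bounded subsets of $S^\nu$) coincides with the inductive limit topology of the spaces $S^{\nu'_m}$.
   Context: Let $\mathbb{N}_0=\{0,1,2,\dots\}$, $\Lambda=\bigcup_{j\in\mathbb{N}_0}\{j\}\times\{0,\dots,2^j-1\}$ and $\Omega=\mathbb{C}^\Lambda$. An admissible profile is a non-decreasing right-continuous function $\nu:\mathbb{R}\to\{-\infty\}\cup[0,1]$ that is not identically $-\infty$. The asymptotic profile of $x\in\Omega$ is $\nu_x(\alpha)=\lim_{\varepsilon\to0^+}\limsup_{j\to\infty}\frac{\log \#\{k:|x_{j,k}|\ge 2^{-(\alpha+\varepsilon)j}\}}{\log(2^j)}$ (with $\log 0=-\infty$), and $S^\nu=\{x\in\Omega:\nu_x(\alpha)\le\nu(\alpha)\ \forall\alpha\in\mathbb{R}\}$, which is a vector space. For $\alpha\in\mathbb{R}$ and $\beta\in\{-\infty\}\cup[0,+\infty)$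 let $d_{\alpha,\beta}(x,y)=d_{\alpha,\beta}(x-y)$ with $d_{\alpha,\beta}(x)=\inf\{C\ge0:\ \forall j\in\mathbb{N}_0,\ \#\{k:|x_{j,k}|\ge C2^{-\alpha j}\}\le C2^{\beta j}\}$ (with $2^{\beta j}:=0$ if $\beta=-\infty$), and let $E(\alpha,\beta)=\{x\in\Omega:d_{\alpha,\beta}(x)<\infty\}$ with the metric $d_{\alpha,\beta}$. For any sequence $(\alpha_n)$ dense in $\mathbb{R}$ and any sequence $e_m\searrow0$ of positive reals, $S^\nu=\bigcap_{n,m}E(\alpha_n,\nu(\alpha_n)+e_m)$, and the topology of $S^\nu$ is the coarsest topology making all inclusions $S^\nu\subset E(\alpha_n,\nu(\alpha_n)+e_m)$ continuous. It is known that this topology does not depend on the choice of these sequences and makes $S^\nu$ a complete metrizable topological vector space. The right-inf derivative, where $\nu(\alpha)>-\infty$, is $\underline{\partial}^+\nu(\alpha)=\liminf_{h\to0^+}\frac{\nu(\alpha+h)-\nu(\alpha)}{h}$. Convention: $\inf\emptyset=+\infty$. Dual profile: put $[\![\beta]\!]=-\infty$ if $\beta<0$, $[\![\beta]\!]=\beta$ if $0\le\beta\le1$, $[\![\beta]\!]=1$ if $\beta\ge1$ (including $\beta=+\infty$). The dual profile of $\nu$ is $\nu':\alpha'\mapsto[\![\alpha'+\inf\{\alpha:\nu(\alpha)-\alpha>\alpha'\}]\!]$. It is an admissible profile, as are the $\nu'_m$, so each $S^{\nu'_m}$ is defined and topologized in the same way as $S^\nu$. Identification of the dual: the topological dual $(S^\nu)'$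 is identified with the set of sequences $\bigcup_{\varepsilon>0}S^{\nu'(\cdot-\varepsilon)}=\bigcup_m S^{\nu'_m}$ by letting the sequence $y$ correspond to the linear form $x\mapsto\langle x,y\rangle=\sum_{(j,k)\in\Lambda}x_{j,k}\overline{y_{j,k}}$. The inductive limit topology is the finest vector space topology on the union making each inclusion $S^{\nu'_m}\subset\bigcup_m S^{\nu'_m}$ continuous. *)

(* Defs.v *)
From HB Require Import structures.
From mathcomp Require Import all_boot all_order all_algebra.
From mathcomp Require Import all_classical all_reals all_analysis.
From mathcomp Require Import complex.
From mathcomp.analysis.showcase Require summability.

Set Implicit Arguments.
Unset Strict Implicit.
Unset Printing Implicit Defensive.

Import Order.TTheory GRing.Theory Num.Theory.
Import numFieldNormedType.Exports.

Local Open Scope classical_set_scope.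
Local Open Scope ring_scope.

Definition Lambda := {j : nat & 'I_(2 ^ j)}.

Definition lam (j : nat) (k : 'I_(2 ^ j)) : Lambda :=
  Tagged (fun j => 'I_(2 ^ j)) k.

(* [R[i]^o] is the field of complex numbers as a normed space over itself *)
Notation Omega R := (Lambda -> R[i]^o).

Definition card_ge (R : realType) (x : Omega R) (j : nat) (t : R) : nat :=
  #|[pred k : 'I_(2 ^ j) | t <= Normc.normc (x (lam k))]|.

Definition admissible (R : realType) (nu : R -> \bar R) : Prop :=
  [/\ forall a b : R, a <= b -> (nu a <= nu b)%E,
      forall a : R, nu b @[b --> a^'+] --> nu a,
      forall a : R, (nu a = -oo \/ 0 <= nu a <= 1)%E
    & exists a : R, nu a <> -oo%E].

(* At j = 0 the quotient log # / 0 is 0 here; this does not affect the limsup. *)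
Definition log_count (R : realType) (x : Omega R) (a e : R) (j : nat) : \bar R :=
  (lne ((card_ge x j (2 `^ (- ((a + e) * j%:R))))%:R)%:E
   * ((ln (2 ^+ j))^-1)%:E)%E.

Definition asymptotic_profile (R : realType) (x : Omega R) (a : R) : \bar R :=
  lim (limn_esup (log_count x a e) @[e --> 0^'+]).

Definition Snu_set (R : realType) (nu : R -> \bar R) : set (Omega R) :=
  [set x | forall a : R, (asymptotic_profile x a <= nu a)%E].

(* [pow2 b j] is 2^(b j), with value 0 at b = -oo, also for j = 0.  The value
   at b = +oo does not occur for admissible profiles; it makes the inclusion of
   S^nu into E(a, nu a + e) hold for every function nu. *)
Definition pow2 (R : realType) (b : \bar R) (j : nat) : \bar R :=
  match b with
  | r%:E => (2 `^ (r * j%:R))%:E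
  | +oo => +oo
  | -oo => 0
  end%E.

Definition dist_bounds (R : realType) (a : R) (b : \bar R) (x : Omega R) : set R :=
  [set C : R | 0 <= C /\ forall j,
    ((card_ge x j (C * 2 `^ (- (a * j%:R))))%:R%:E <= C%:E * pow2 b j)%E].

Definition dist (R : realType) (a : R) (b : \bar R) (x : Omega R) : \bar R :=
  ereal_inf [set C%:E | C in dist_bounds a b x].

Lemma normcB (R : realType) (x y : R[i]^o) :
  Normc.normc (x - y) = Normc.normc (y - x).
Proof. by rewrite -(normcN (x - y)) opprB. Qed.

Lemma le_card_ge (R : realType) (x y : Omega R) j (s t : R) :
  (forall k : 'I_(2 ^ j), t <= Normc.normc (y (lam k)) ->
    s <= Normc.normc (x (lam k))) ->
  (card_ge y j t <= card_ge x j s)%N.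
Proof.
move=> h; apply: subset_leq_card; apply/fintype.subsetP => k.
by rewrite !inE; exact: h.
Qed.

Lemma card_geD (R : realType) (x y : Omega R) j (s t : R) :
  (card_ge (x + y)%R j (s + t)%R <= card_ge x j s + card_ge y j t)%N.
Proof.
rewrite /card_ge -cardUI; apply: leq_trans (leq_addr _ _).
apply: subset_leq_card; apply/fintype.subsetP => k; rewrite !inE => h.
case: leP => //= xs; case: leP => //= yt.
move: h; rewrite leNgt => /negP; case.
by apply: le_lt_trans (le_normcD _ _) _; rewrite ltrD.
Qed.

Lemma card_ge_eq0 (R : realType) (x : Omega R) j (t : R) :
  (forall k : 'I_(2 ^ j), Normc.normc (x (lam k)) < t) -> card_ge x j t = 0%N.
Proof.
move=> h; apply: eq_card0 => k; rewrite !inE; apply/negbTE.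
by rewrite -ltNge.
Qed.

Lemma pow2_ge0 (R : realType) (b : \bar R) j : (0 <= pow2 b j)%E.
Proof. by case: b => [r| |] //=; rewrite ?lee_fin ?powR_ge0 // leey. Qed.

Lemma dist0 (R : realType) (a : R) (b : \bar R) : dist a b (0 : Omega R) = 0%E.
Proof.
apply/eqP; rewrite eq_le; apply/andP; split; last first.
  by apply: le_ereal_inf_tmp => _ [C [C0 _] <-]; rewrite lee_fin.
apply/lee_addgt0Pr => e e0; rewrite add0e; apply: ereal_inf_lbound.
exists e => //; split; first exact: ltW.
move=> j; rewrite card_ge_eq0 => [|k]; first by
  rewrite mule_ge0// ?pow2_ge0// lee_fin ltW.
by rewrite Normc.normc0 mulr_gt0// powR_gt0.
Qed.

Lemma distB (R : realType) (a : R) (b : \bar R) (x y : Omega R) :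
  dist a b (x - y) = dist a b (y - x).
Proof.
rewrite /dist /dist_bounds; congr (ereal_inf (_ @` _)); apply/seteqP.
have E (u v : Omega R) j t : card_ge (u - v) j t = card_ge (v - u) j t.
  apply: eq_card => k; rewrite !inE.
  have -> : (u - v) (lam k) = u (lam k) - v (lam k) by [].
  by rewrite normcB.
by split=> C [C0 h]; split => // j; rewrite E.
Qed.

Lemma distD (R : realType) (a : R) (b : \bar R) (x y : Omega R) (r s : R) :
  (dist a b x < r%:E)%E -> (dist a b y < s%:E)%E ->
  (dist a b (x + y)%R < (r + s)%:E)%E.
Proof.
move=> /ereal_inf_lt[_ [C [C0 xC] <-]]; rewrite lte_fin => Cr.
move=> /ereal_inf_lt[_ [D [D0 yD] <-]]; rewrite lte_fin => Ds.
apply: (@le_lt_trans _ _ (C + D)%:E); last by rewrite lte_fin ltrD.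
apply: ereal_inf_lbound; exists (C + D) => //; split; first exact: addr_ge0.
move=> j; rewrite mulrDl EFinD ge0_muleDl ?lee_fin//.
apply: le_trans (leeD (xC j) (yD j)).
by rewrite -EFinD lee_fin -natrD ler_nat card_geD.
Qed.

(* E(a, b) is given the pseudometric structure rather than the metric one because
   b is an arbitrary extended real here: for b = +oo the distance is 0. *)
Definition Espace (R : realType) (a : R) (b : \bar R) : Type :=
  {x : Omega R | (dist a b x < +oo)%E}.

HB.instance Definition _ (R : realType) (a : R) (b : \bar R) :=
  Choice.on (Espace a b).

Definition Espace_ball (R : realType) (a : R) (b : \bar R)
    (x : Espace a b) (r : R) : set (Espace a b) :=
  [set y | (dist a b (sval x - sval y)%R < r%:E)%E].

Lemma Espace_ball_center (R : realType) (a : R) (b : \bar R)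
  (x : Espace a b) (r : R) : 0 < r -> Espace_ball x r x.
Proof. by move=> r0; rewrite /Espace_ball /= subrr dist0 lte_fin. Qed.

Lemma Espace_ball_sym (R : realType) (a : R) (b : \bar R)
  (x y : Espace a b) (r : R) : Espace_ball x r y -> Espace_ball y r x.
Proof. by rewrite /Espace_ball /= distB. Qed.

Lemma Espace_ball_triangle (R : realType) (a : R) (b : \bar R)
    (x y z : Espace a b) (r s : R) :
  Espace_ball x r y -> Espace_ball y s z -> Espace_ball x (r + s) z.
Proof.
rewrite /Espace_ball /= => xy yz; have := distD xy yz.
by rewrite addrA subrK.
Qed.

HB.instance Definition _ (R : realType) (a : R) (b : \bar R) :=
  hasNbhs.Build (Espace a b) (nbhs_ (entourage_ (@Espace_ball R a b))).

HB.instance Definition _ (R : realType) (a : R) (b : \bar R) :=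
  @Nbhs_isPseudoMetric.Build R (Espace a b) (entourage_ (@Espace_ball R a b))
    erefl (@Espace_ball R a b) (@Espace_ball_center R a b)
    (@Espace_ball_sym R a b) (@Espace_ball_triangle R a b) erefl.

Definition card_ge_bounded (R : realType) (x : Omega R) (a b : R) : Prop :=
  exists2 e : R, 0 < e & \forall j \near \oo,
    (card_ge x j (2 `^ (- ((a + e) * j%:R))))%:R <= 2 `^ (b * j%:R).

Lemma log_count_le (R : realType) (x : Omega R) (a e b : R) (j : nat) :
  (0 < j)%N ->
  (log_count x a e j <= b%:E)%E =
  ((card_ge x j (2 `^ (- ((a + e) * j%:R))))%:R <= 2 `^ (b * j%:R)).
Proof.
move=> j0; rewrite /log_count; set n := card_ge _ _ _.
have l2 : 0 < ln (2 : R) by rewrite ln_gt0// ltr1n.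
have L : 0 < ln (2 ^+ j : R) by rewrite lnXn// pmulrn_rgt0.
case: (posnP n) => [->|n0].
  rewrite le0_lneNy// gt0_mulNye ?lte_fin ?invr_gt0//.
  by rewrite leNye powR_ge0.
rewrite lne_EFin ?ltr0n// -EFinM lee_fin ler_pdivrMr//.
rewrite -[RHS]ler_ln ?posrE ?ltr0n ?powR_gt0// ln_powR lnXn//.
by rewrite -mulrA mulr_natl.
Qed.

Lemma log_count_homo (R : realType) (x : Omega R) (a e f : R) (j : nat) :
  e <= f -> (log_count x a e j <= log_count x a f j)%E.
Proof.
move=> ef; rewrite /log_count; apply: lee_wpmul2r.
  by rewrite lee_fin invr_ge0 ln_ge0// exprn_ege1// ler1n.
rewrite lee_lne ?in_itv/= ?leey ?lee_fin ?ler0n// ler_nat.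
apply: le_card_ge => k; apply: le_trans.
by rewrite ler_powR ?ler1n// lerN2 ler_wpM2r// lerD2l.
Qed.

Lemma limn_esup_homo (R : realType) (u v : (\bar R)^nat) :
  (forall j, u j <= v j)%E -> (limn_esup u <= limn_esup v)%E.
Proof.
move=> uv; apply: le_ereal_inf_tmp => _ [V FV <-].
apply: (@le_trans _ _ (ereal_sup (u @` V))).
  by apply: ereal_inf_lbound; exists V.
apply: ub_ereal_sup => _ [j Vj <-]; apply: le_trans (uv j) _.
by apply: ereal_sup_ubound; exists j.
Qed.

Lemma asymptotic_profileE (R : realType) (x : Omega R) (a : R) :
  asymptotic_profile x a =
  ereal_inf [set limn_esup (log_count x a e) | e in `]0, 1[].
Proof.
apply: cvg_lim; first exact: ereal_hausdorff.
apply: (@nondecreasing_at_right_cvge R _ 0 (BLeft 1)).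
  by rewrite bnd_simp.
move=> e f _ _ ef; apply: limn_esup_homo => j.
exact: log_count_homo.
Qed.

Lemma asymptotic_profile_lt (R : realType) (x : Omega R) (a b : R) :
  (asymptotic_profile x a < b%:E)%E -> card_ge_bounded x a b.
Proof.
rewrite asymptotic_profileE => /ereal_inf_lt[_ [e /= + <-]].
rewrite in_itv/= => /andP[e0 _] /ereal_inf_lt[_ [V FV <-]] Vb.
exists e => //; near=> j.
rewrite -log_count_le; last by near: j; exists 1%N.
apply: le_trans (ltW Vb); apply: ereal_sup_ubound; exists j => //.
by near: j.
Unshelve. all: by end_near. Qed.

Lemma asymptotic_profile_le (R : realType) (x : Omega R) (a b : R) :
  card_ge_bounded x a b -> (asymptotic_profile x a <= b%:E)%E.
Proof.
move=> [e e0 xb]; rewrite asymptotic_profileE.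
pose f := Num.min e (2^-1).
have f0 : 0 < f by rewrite lt_min e0 invr_gt0 ltr0n.
have f1 : f < 1 by rewrite gt_min invf_lt1// ltr1n orbT.
have fe : f <= e by rewrite ge_min lexx.
apply: (@le_trans _ _ (limn_esup (log_count x a f))).
  by apply: ereal_inf_lbound; exists f => //=; rewrite in_itv/= f0.
apply: (@le_trans _ _ (limn_esup (log_count x a e))).
  by apply: limn_esup_homo => j; exact: log_count_homo.
pose V := [set j | (log_count x a e j <= b%:E)%E].
apply: (@le_trans _ _ (ereal_sup (log_count x a e @` V))).
  apply: ereal_inf_lbound; exists V => //.
  near=> j; rewrite /V /= log_count_le; first by near: j.
  by near: j; exists 1%N.
by apply: ub_ereal_sup => _ [j Vj <-].
Unshelve. all: by end_near. Qed.

Lemma le_of_lt_fin (R : realType) (m n : \bar R) :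
  (forall b : R, (n < b%:E)%E -> (m <= b%:E)%E) -> (m <= n)%E.
Proof.
case: n => [r| |] h; last 2 first.
- by rewrite leey.
- case: m h => [s| |] h //; last by have := h 0 (ltNyr _).
  by have := h (s - 1) (ltNyr _); rewrite lee_fin lerBrDr gerDl ler10.
- by apply/lee_addgt0Pr => e e0; apply: h; rewrite lte_fin ltrDl.
Qed.

Lemma lt_fin_dense (R : realType) (n : \bar R) (b : R) :
  (n < b%:E)%E -> exists2 c : R, (n < c%:E)%E & c < b.
Proof.
case: n => [r| |] // h.
- rewrite lte_fin in h; exists ((r + b) / 2).
    by rewrite lte_fin; exact: (midf_lt h).1.
  exact: (midf_lt h).2.
- by exists (b - 1); [exact: ltNyr|rewrite ltrBlDr ltrDl].
Qed.

Lemma Snu_setP (R : realType) (nu : R -> \bar R) (x : Omega R) :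
  Snu_set nu x <->
  forall a b : R, (nu a < b%:E)%E -> card_ge_bounded x a b.
Proof.
split=> [h a b ab|h a].
  by apply: asymptotic_profile_lt; apply: le_lt_trans ab.
by apply: le_of_lt_fin => b ab; apply: asymptotic_profile_le; exact: h.
Qed.

Lemma le_powR_near (R : realType) (c b b' : R) : b < b' ->
  \forall j \near \oo, c * 2 `^ (b * j%:R) <= 2 `^ (b' * j%:R).
Proof.
move=> bb'; pose q : R := 2 `^ (b - b').
have q0 : 0 < q by rewrite powR_gt0.
have q1 : `|q| < 1.
  rewrite ger0_norm ?ltW// /q /powR pnatr_eq0/= -[ltRHS]expR0 ltr_expR.
  by rewrite pmulr_llt0 ?subr_lt0// ln_gt0// ltr1n.
have /cvgrPdist_lt/(_ 1 ltr01) := @cvg_geometric R c q q1.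
apply: filterS => j; rewrite sub0r normrN /geometric/= => h.
have {}h : c * q ^+ j <= 1 by exact: ltW (le_lt_trans (ler_norm _) h).
have -> : b * j%:R = (b - b') * j%:R + b' * j%:R by rewrite -mulrDl subrK.
rewrite powRD ?pnatr_eq0 ?implybT// powRrM powR_mulrn ?powR_ge0// mulrA.
by rewrite ler_piMl// powR_ge0.
Qed.

Lemma Snu_set0 (R : realType) (nu : R -> \bar R) : Snu_set nu 0.
Proof.
apply/Snu_setP => a b _; exists 1 => //; near=> j.
rewrite card_ge_eq0 ?powR_ge0// => k.
by rewrite Normc.normc0 powR_gt0.
Unshelve. all: by end_near. Qed.

Lemma card_ge_boundedD (R : realType) (x y : Omega R) (a b c : R) :
  b < c -> card_ge_bounded x a b -> card_ge_bounded y a b ->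
  card_ge_bounded (x + y) a c.
Proof.
move=> bc [e e0 xb] [f f0 yb].
pose g := Num.min e f / 2.
have ef0 : 0 < Num.min e f by rewrite lt_min e0.
have g0 : 0 < g by rewrite divr_gt0.
exists g => //; near=> j.
pose t (u : R) : R := 2 `^ (- ((a + u) * j%:R)).
have tE u : g + g <= u -> t u + t u <= t g.
  move=> gu.
  have : (2 : R) * 2 `^ (- (a + u) * j%:R) <= 2 `^ (- (a + g) * j%:R).
    apply: (@le_trans _ _ (2 * 2 `^ (- (a + (g + g)) * j%:R))).
      rewrite ler_pM2l// ler_powR ?ler1n// ler_wpM2r// lerN2 lerD2l.
      by [].
    near: j; apply: le_powR_near.
    by rewrite ltrN2 ltrD2l ltrDl.
  by rewrite !mulNr -/(t u) -/(t g) mulr_natl mulr2n.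
have ge : g + g <= e by rewrite -splitr ge_min lexx.
have gf : g + g <= f by rewrite -splitr ge_min lexx orbT.
rewrite -/(t g).
have h1 : (card_ge (x + y)%R j (t g) <= card_ge x j (t e) + card_ge y j (t f))%N.
  apply: leq_trans (card_geD _ _ _ _ _).
  apply: le_card_ge => k; apply: le_trans.
  have te := tE _ ge; have tf := tE _ gf.
  rewrite -(ler_pM2l (ltr0n R 2)) !mulr_natl !mulr2n.
  by rewrite addrACA lerD.
apply: (@le_trans _ _ (2 * 2 `^ (b * j%:R))); last first.
  by near: j; exact: le_powR_near.
apply: le_trans (_ : (_ <= (card_ge x j (t e) + card_ge y j (t f))%:R)) _.
  by rewrite ler_nat.
rewrite natrD mulr_natl mulr2n; apply: lerD; rewrite /t; by near: j.
Unshelve. all: by end_near. Qed.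

Lemma Snu_setD (R : realType) (nu : R -> \bar R) (x y : Omega R) :
  Snu_set nu x -> Snu_set nu y -> Snu_set nu (x + y).
Proof.
move=> /Snu_setP xS /Snu_setP yS; apply/Snu_setP => a b ab.
have [c ac cb] := lt_fin_dense ab.
by apply: card_ge_boundedD cb _ _; [exact: xS|exact: yS].
Qed.

Lemma Snu_setZ (R : realType) (nu : R -> \bar R) (z : R[i]) (x : Omega R) :
  Snu_set nu x -> Snu_set nu (z *: x).
Proof.
move=> /Snu_setP xS; apply/Snu_setP => a b ab.
have [e e0 xb] := xS _ _ ab.
have e20 : 0 < e / 2 by rewrite divr_gt0.
exists (e / 2) => //; near=> j.
apply: (@le_trans _ _ (card_ge x j (2 `^ (- ((a + e) * j%:R))))%:R); last first.
  by near: j.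
have h : (Normc.normc z + 1) * 2 `^ (- (a + e) * j%:R)
         <= 2 `^ (- (a + e / 2) * j%:R).
  near: j; apply: le_powR_near.
  by rewrite ltrN2 ltrD2l ltr_pdivrMr// ltr_pMr// ltr1n.
rewrite ler_nat; apply: le_card_ge => k.
have -> : (z *: x) (lam k) = z * x (lam k) by [].
rewrite Normc.normcM.
rewrite -!mulNr => h'; have := le_trans h h'.
have z0 : 0 <= Normc.normc z by case: (z) => ? ?; exact: sqrtr_ge0.
move=> h2; rewrite -(@ler_pM2l _ (Normc.normc z + 1)) ?ltr_wpDl//.
apply: le_trans h2 _; rewrite ler_wpM2r ?lerDl//.
by case: (x _) => ? ?; exact: sqrtr_ge0.
Unshelve. all: by end_near. Qed.

Lemma Snu_set_submod_closed (R : realType) (nu : R -> \bar R) :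
  @GRing.submod_closed R[i] (Omega R) (mem (Snu_set nu)).
Proof.
split; first exact/mem_set/Snu_set0.
move=> z x y /set_mem xS /set_mem yS.
exact/mem_set/(Snu_setD (Snu_setZ z xS) yS).
Qed.

Lemma le_Snu_set (R : realType) (nu mu : R -> \bar R) :
  (forall a, nu a <= mu a)%E -> Snu_set nu `<=` Snu_set mu.
Proof. by move=> le_nu x xS a; apply: le_trans (xS a) (le_nu a). Qed.

Lemma dist_lty (R : realType) (a f : R) (b : \bar R) (x : Omega R) : 0 < f ->
  (\forall j \near \oo,
    (card_ge x j (2 `^ (- ((a + f) * j%:R))))%:R%:E <= pow2 b j)%E ->
  (dist a b x < +oo)%E.
Proof.
move=> f0 [N _ xN].
have nc0 (z : R[i]) : 0 <= Normc.normc z by case: z => ? ?; exact: sqrtr_ge0.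
pose F j := \sum_(k < 2 ^ j) Normc.normc (x (lam k)) * 2 `^ (a * j%:R).
have F0 j : 0 <= F j.
  by apply: sumr_ge0 => k _; rewrite mulr_ge0 ?powR_ge0 ?nc0.
pose C := 1 + \sum_(j < N) F j.
have C1 : 1 <= C by rewrite lerDl sumr_ge0.
have C0 : 0 <= C by exact: le_trans C1.
apply: (@le_lt_trans _ _ C%:E); last exact: ltry.
apply: ereal_inf_lbound; exists C => //; split => // j.
have [jN|Nj] := ltnP j N.
  rewrite card_ge_eq0 => [|k]; first by rewrite mule_ge0// pow2_ge0.
  rewrite powRN ltr_pdivlMr ?powR_gt0//.
  apply: (@le_lt_trans _ _ (F j)).
    rewrite /F (bigD1 k)//= lerDl sumr_ge0// => i _.
    by rewrite mulr_ge0 ?powR_ge0 ?nc0.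
  apply: (@le_lt_trans _ _ (\sum_(j < N) F j)); last by rewrite ltrDr.
  by rewrite (bigD1 (Ordinal jN))//= lerDl sumr_ge0.
apply: le_trans (_ : (_ <= (card_ge x j (2 `^ (- ((a + f) * j%:R))))%:R%:E)%E) _.
  rewrite lee_fin ler_nat; apply: le_card_ge => k; apply: le_trans.
  apply: (@le_trans _ _ (2 `^ (- (a * j%:R)))).
    by rewrite ler_powR ?ler1n// lerN2 ler_wpM2r// lerDl ltW.
  by rewrite ler_peMl// powR_ge0.
apply: le_trans (xN j Nj) _.
by rewrite -[leLHS]mul1e lee_wpmul2r ?pow2_ge0// lee_fin.
Qed.

Lemma Snu_sub_Espace (R : realType) (nu : R -> \bar R) (a : R) (e : {posnum R})
  (x : Omega R) : Snu_set nu x -> (dist a (nu a + e%:num%:E) x < +oo)%E.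
Proof.
move=> /Snu_setP/(_ a); case: (nu a) => [r| |] xS.
- have [|f f0 xf] := xS (r + e%:num); first by rewrite lte_fin ltrDl.
  apply: dist_lty f0 _; move: xf; apply: filterS => j.
  by rewrite /= lee_fin.
- rewrite addye//; apply: (@dist_lty _ _ 1) => //.
  by near=> j; rewrite /= leey.
- have [|f f0 xf] := xS (-1); first exact: ltNyr.
  rewrite addNye; apply: dist_lty f0 _; near=> j.
  rewrite /= lee_fin; set n := card_ge _ _ _.
  suff : (n < 1)%N by rewrite ltnS leqn0 => /eqP ->.
  rewrite -(ltr_nat R); apply: (@le_lt_trans _ _ (2 `^ (-1 * j%:R))).
    by rewrite /n; near: j.
  have j0 : (0 < j)%N by near: j; exists 1%N.
  rewrite mulN1r powRN invf_lt1 ?powR_gt0// powR_mulrn//.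
  by rewrite exprn_egt1// ?ltr1n// -lt0n.
Unshelve. all: by end_near. Qed.

Definition Snu_pred (R : realType) (nu : R -> \bar R) : {pred Omega R} :=
  mem (Snu_set nu).

HB.instance Definition _ (R : realType) (nu : R -> \bar R) :=
  GRing.isSubmodClosed.Build R[i] (Omega R) (Snu_pred nu)
    (Snu_set_submod_closed nu).

(* The sequences [alpha] and [e] only serve to fix the topology of this type. *)
Definition Snu (R : realType) (nu : R -> \bar R)
    (alpha : nat -> R) (e : nat -> {posnum R}) : Type :=
  {x : Omega R | x \in Snu_pred nu}.

HB.instance Definition _ (R : realType) (nu : R -> \bar R)
    (alpha : nat -> R) (e : nat -> {posnum R}) :=
  SubChoice.on (Snu nu alpha e).
HB.instance Definition _ (R : realType) (nu : R -> \bar R)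
    (alpha : nat -> R) (e : nat -> {posnum R}) :=
  [SubChoice_isSubLmodule of Snu nu alpha e by <:].

Lemma SnuP (R : realType) (nu : R -> \bar R) alpha e (x : Snu nu alpha e) :
  Snu_set nu (val x).
Proof. exact/set_mem/(valP x). Qed.

Definition Snu_incl (R : realType) (nu : R -> \bar R)
    (alpha : nat -> R) (e : nat -> {posnum R}) (n m : nat) (x : Snu nu alpha e) :
    Espace (alpha n) (nu (alpha n) + (e m)%:num%:E)%E :=
  exist _ (val x) (Snu_sub_Espace (alpha n) (e m) (SnuP x)).

HB.instance Definition _ (R : realType) (nu : R -> \bar R)
    (alpha : nat -> R) (e : nat -> {posnum R}) :=
  Topological.copy (Snu nu alpha e)
    (sup_topology (fun nm : nat * nat => Topological.class
      (initial_topology (@Snu_incl R nu alpha e nm.1 nm.2)))).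

Definition vn_bounded (K : numFieldType) (V : preTopologicalLmodType K)
    (B : set V) : Prop :=
  forall U : set V, nbhs (0 : V) U ->
    exists2 r : K, 0 < r &
      forall t : K, r <= `|t| -> B `<=` [set t *: v | v in U].

Definition topological_dual (K : numFieldType) (V : preTopologicalLmodType K) :
    set (V -> K^o) :=
  [set f | linear f /\ continuous f].
Arguments topological_dual {K} V.

Definition vector_topology (K : numFieldType) (V : lmodType K)
    (tau : Topological V) : Prop :=
  let T := Topological.Pack tau in
  continuous (fun z : T * T => (z.1 : V) + (z.2 : V) : T) /\
  continuous (fun z : K^o * T => (z.1 : K) *: (z.2 : V) : T).

Definition finest_vector_topology (K : numFieldType) (V : lmodType K)
    (I : Type) (E : I -> topologicalType) (f : forall i, E i -> V)
    (tau : Topological V) : Prop :=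
  let making_continuous (sigma : Topological V) :=
    vector_topology sigma /\
    forall i, continuous (f i : E i -> Topological.Pack sigma) in
  making_continuous tau /\
  forall sigma : Topological V, making_continuous sigma ->
    @open (Topological.Pack sigma) `<=` @open (Topological.Pack tau).

Definition right_inf_derivative (R : realType) (nu : R -> \bar R) (a : R) :
    \bar R :=
  limf_einf (fun h : R => (nu (a + h)%R - nu a) * (h^-1)%:E)%E 0^'+.

Definition p0 (R : realType) (nu : R -> \bar R) : \bar R :=
  Order.min 1%E
    (ereal_inf [set right_inf_derivative nu a | a in [set a | (0 <= nu a < 1)%E]]).

Definition alpha_min (R : realType) (nu : R -> \bar R) : \bar R :=
  ereal_inf [set a%:E | a in [set a | (0 <= nu a)%E]].

Definition clip (R : realType) (b : \bar R) : \bar R :=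
  (if b < 0 then -oo else Order.min b 1)%E.

Definition dual_profile (R : realType) (nu : R -> \bar R) (a' : R) : \bar R :=
  clip (a'%:E + ereal_inf [set a%:E | a in [set a | nu a - a%:E > a'%:E]])%E.

Definition shift_profile (R : realType) (nu : R -> \bar R) (e a : R) : \bar R :=
  nu (a - e).

Definition dual_set (R : realType) (nu : R -> \bar R) : set (Omega R) :=
  \bigcup_(e in [set e : R | 0 < e]) Snu_set (shift_profile (dual_profile nu) e).

Lemma clip_homo (R : realType) (b c : \bar R) : (b <= c)%E -> (clip b <= clip c)%E.
Proof.
move=> bc; rewrite /clip; case: ifPn => [_|b0]; first by rewrite leNye.
rewrite ifF; last first.
  by apply/negbTE; move: b0; rewrite -!leNgt => b0; exact: le_trans bc.
by rewrite le_min !ge_min bc lexx orbT.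
Qed.

Lemma dual_profile_homo (R : realType) (nu : R -> \bar R) (a b : R) :
  a <= b -> (dual_profile nu a <= dual_profile nu b)%E.
Proof.
move=> ab; apply: clip_homo; apply: leeD; first by rewrite lee_fin.
apply: ereal_inf_le_tmp; apply: image_subset => c /=.
by apply: le_lt_trans; rewrite lee_fin.
Qed.

Lemma shift_dual_profile_homo (R : realType) (nu : R -> \bar R) (e f a : R) :
  e <= f ->
  (shift_profile (dual_profile nu) f a <= shift_profile (dual_profile nu) e a)%E.
Proof. by move=> ef; apply: dual_profile_homo; rewrite lerD2l lerN2. Qed.

Lemma dual_set_submod_closed (R : realType) (nu : R -> \bar R) :
  @GRing.submod_closed R[i] (Omega R) (mem (dual_set nu)).
Proof.
split; first by apply: mem_set; exists 1; [exact: ltr01|exact: Snu_set0].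
move=> z x y /set_mem[e e0 xS] /set_mem[f f0 yS].
apply/mem_set; exists (Num.min e f); first by rewrite /= lt_min e0.
have {}xS : Snu_set (shift_profile (dual_profile nu) (Num.min e f)) x.
  apply: le_Snu_set xS => a; apply: shift_dual_profile_homo.
  by rewrite ge_min lexx.
have {}yS : Snu_set (shift_profile (dual_profile nu) (Num.min e f)) y.
  apply: le_Snu_set yS => a; apply: shift_dual_profile_homo.
  by rewrite ge_min lexx orbT.
exact: (Snu_setD (Snu_setZ z xS) yS).
Qed.

Lemma dual_set_bigcup (R : realType) (nu : R -> \bar R)
    (eps : nat -> {posnum R}) : (eps m)%:num @[m --> \oo] --> (0 : R) ->
  dual_set nu =
  \bigcup_m Snu_set (shift_profile (dual_profile nu) (eps m)%:num).
Proof.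
move=> eps0; apply/seteqP; split=> x [e].
  move=> e0 xS; move/cvgrPdist_lt : eps0 => /(_ e e0) [m _ /(_ m (leqnn m))].
  rewrite sub0r normrN gtr0_norm// => em; exists m => //.
  apply: le_Snu_set xS => a; apply: shift_dual_profile_homo; exact: ltW.
by move=> _ xS; exists (eps e)%:num => /=.
Qed.

Definition dual_pred (R : realType) (nu : R -> \bar R) : {pred Omega R} :=
  mem (dual_set nu).

HB.instance Definition _ (R : realType) (nu : R -> \bar R) :=
  GRing.isSubmodClosed.Build R[i] (Omega R) (dual_pred nu)
    (dual_set_submod_closed nu).

(* By [dual_set_bigcup] this is also the union of the spaces S^{nu'_m}. *)
Definition dual_seqs (R : realType) (nu : R -> \bar R) : Type :=
  {y : Omega R | y \in dual_pred nu}.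

HB.instance Definition _ (R : realType) (nu : R -> \bar R) :=
  SubChoice.on (dual_seqs nu).
HB.instance Definition _ (R : realType) (nu : R -> \bar R) :=
  [SubChoice_isSubLmodule of dual_seqs nu by <:].

Lemma Snu_dual_set (R : realType) (nu : R -> \bar R) (e : {posnum R}) (y : Omega R) :
  Snu_set (shift_profile (dual_profile nu) e%:num) y -> y \in dual_pred nu.
Proof. by move=> yS; apply/mem_set; exists e%:num => /=. Qed.

Definition dual_incl (R : realType) (nu : R -> \bar R)
    (alpha : nat -> R) (e : nat -> {posnum R}) (eps : {posnum R})
    (y : Snu (shift_profile (dual_profile nu) eps%:num) alpha e) : dual_seqs nu :=
  exist _ (val y) (Snu_dual_set (SnuP y)).

Definition pairing_terms (R : realType) (x y : Omega R) (l : Lambda) : R[i]^o :=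
  x l * (y l)^*.

(* The sum is unordered: the limit is along the finite subsets of Lambda. *)
Definition pairing (R : realType) (x y : Omega R) : R[i]^o :=
  lim (summability.partial_sum (pairing_terms x y) @ summability.totally).

Definition dual_form (R : realType) (nu : R -> \bar R)
    (alpha : nat -> R) (e : nat -> {posnum R}) (y : dual_seqs nu) :
    {family @vn_bounded _ (Snu nu alpha e), Snu nu alpha e -> R[i]^o} :=
  fun x => pairing (val x) (val y).

(* The topology of uniform convergence on the bounded subsets of S^nu, transported
   to the set of sequences along y |-> <., y>. *)
Definition strong_topology (R : realType) (nu : R -> \bar R)
    (alpha : nat -> R) (e : nat -> {posnum R}) : Topological (dual_seqs nu) :=
  Topological.class (initial_topology (@dual_form R nu alpha e)).

(* Main.v *)
(* If x is in S^nu and y is in S^(nu'(. - eps)), then at level j about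
   2^(min (nu a) (nu' (a' - eps)) j) indices k have |x_jk| ~ 2^(-aj) and
   |y_jk| ~ 2^(-a'j).  By definition of the dual profile the minimum is at most
   a + a' - eps, so level j contributes O(2^(-eps' j)) to the pairing, with
   constants uniform on neighbourhoods of 0 of both spaces.  Hence the pairing
   converges absolutely, and the strong topology is coarser than the inductive
   limit topology.

   Conversely, testing y against sequences carried by a single level shows that
   the polar of a neighbourhood of 0 of S^nu lies in some S^(nu'_m), where its
   counts are uniformly bounded; so on such a polar coordinatewise convergence
   implies convergence in S^(nu'_m).  This identifies the dual.  As these polars
   are compact for coordinatewise convergence, the Banach-Dieudonne construction
   applies: a set O whose trace on every S^(nu'_m) is open contains, around each
   of its points, a translate of the polar of a bounded set, obtained as a union
   of finite sets F_n contained in smaller and smaller neighbourhoods of 0.  It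
   does not use local convexity of the topology to which O belongs. *)

Require Import Defs.
From HB Require Import structures.
From mathcomp Require Import all_boot all_order all_algebra.
From mathcomp Require Import all_classical all_reals all_analysis.
From mathcomp Require Import complex.
From mathcomp.analysis.showcase Require summability.
From mathcomp Require Import zify ring lra.

Set Implicit Arguments.
Unset Strict Implicit.
Unset Printing Implicit Defensive.

Import Order.TTheory GRing.Theory Num.Theory.
Import numFieldNormedType.Exports.

Local Open Scope classical_set_scope.
Local Open Scope ring_scope.

Local Notation nc := Normc.normc.

Lemma normc_ge0 (R : rcfType) (z : R[i]) : 0 <= nc z.
Proof. by case: z => a b; exact: sqrtr_ge0. Qed.

(** * Neighbourhoods of 0 *)

Lemma dist_lt_card (R : realType) (a : R) b (x : Omega R) r j :
  (dist a b x < r%:E)%E ->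
  ((card_ge x j (r * 2 `^ (- (a * j%:R))))%:R%:E <= r%:E * pow2 b j)%E.
Proof.
move=> /ereal_inf_lt[_ [C [C0 xC] <-]]; rewrite lte_fin => Cr.
apply: (@le_trans _ _ (C%:E * pow2 b j)%E); last first.
  by rewrite lee_wpmul2r ?pow2_ge0// lee_fin ltW.
apply: le_trans (xC j); rewrite lee_fin ler_nat; apply: le_card_ge => k.
by apply: le_trans; rewrite ler_wpM2r ?powR_ge0// ltW.
Qed.

Lemma dist_le (R : realType) (a : R) b (x : Omega R) r : 0 <= r ->
  (forall j, ((card_ge x j (r * 2 `^ (- (a * j%:R))))%:R%:E
              <= r%:E * pow2 b j)%E) ->
  (dist a b x <= r%:E)%E.
Proof. by move=> r0 h; apply: ereal_inf_lbound; exists r. Qed.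

(** The distance is not homogeneous, but a bound [C] for [x] becomes the bound [t * C] for [z]: the
    threshold absorbs the factor, and the allowed count only grows because [1 <= t]. *)
Lemma dist_dominated (R : realType) (a : R) b (x z : Omega R) t r :
  1 <= t -> (forall l, nc (z l) <= t * nc (x l)) ->
  (dist a b x < r%:E)%E -> (dist a b z < (t * r)%:E)%E.
Proof.
move=> t1 zx; have t0 : 0 < t by exact: lt_le_trans t1.
move=> /ereal_inf_lt[_ [C [C0 xC] <-]]; rewrite lte_fin => Cr.
apply: (@le_lt_trans _ _ (t * C)%:E); last by rewrite lte_fin ltr_pM2l.
apply: dist_le => [|j]; first by rewrite mulr_ge0// ltW.
apply: (@le_trans _ _ (C%:E * pow2 b j)%E); last first.
  by rewrite lee_wpmul2r ?pow2_ge0// lee_fin ler_peMl.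
apply: le_trans (xC j); rewrite lee_fin ler_nat; apply: le_card_ge => k h.
by rewrite -(ler_pM2l t0) mulrA; apply: le_trans (zx _).
Qed.

(** One index bounds both parameters and the radius, so these sets decrease and their traces form a
    base of neighbourhoods of 0. They live in [Omega], so that a sequence can be tested before it is
    known to lie in S^nu. *)
Definition Snu_ball (R : realType) (nu : R -> \bar R) (alpha : nat -> R)
    (e : nat -> {posnum R}) (n : nat) : set (Omega R) :=
  [set x | forall i k, (i <= n)%N -> (k <= n)%N ->
    (dist (alpha i) (nu (alpha i) + (e k)%:num%:E) x < n.+1%:R^-1%:E)%E].

Section Snu_ball.
Context {R : realType} (nu : R -> \bar R) (alpha : nat -> R).
Variable e : nat -> {posnum R}.
Local Notation B := (Snu_ball nu alpha e).
Implicit Types x z : Omega R.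

Lemma le_Snu_ball m n : (m <= n)%N -> B n `<=` B m.
Proof.
move=> mn x xB i k im km.
apply: lt_le_trans (xB i k (leq_trans im mn) (leq_trans km mn)) _.
by rewrite lee_fin lef_pV2 ?posrE ?ltr0n// ler_nat.
Qed.

Lemma Snu_ball_dominated x z n : (forall l, nc (z l) <= nc (x l)) ->
  B n x -> B n z.
Proof.
move=> zx xB i k im km; rewrite -[_^-1]mul1r.
by apply: dist_dominated (xB i k im km) => // l; rewrite mul1r.
Qed.

(** Stands in for the missing homogeneity: passing from the ball [n] to the smaller ball [m] absorbs
    the factor [t], uniformly in [x] and [z]. *)
Lemma Snu_ball_scale (t : R) n : exists m, forall x z,
  (forall l, nc (z l) <= t * nc (x l)) -> B m x -> B n z.
Proof.
pose s := Num.max t 1; have s1 : 1 <= s by rewrite le_max lexx orbT.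
pose m := Num.trunc (s * n.+1%:R).
have sn0 : 0 <= s * n.+1%:R by rewrite mulr_ge0// (le_trans _ s1).
have smn : s * n.+1%:R <= m.+1%:R by exact/ltW/truncnS_gt.
have nm : (n <= m)%N.
  rewrite -ltnS -(ler_nat R); apply: le_trans smn.
  by rewrite ler_peMl.
exists m => x z zx xB i k im km.
have := xB i k (leq_trans im nm) (leq_trans km nm).
move=> /(@dist_dominated _ _ _ x z s) h.
apply: lt_le_trans (h _ _) _ => //.
  move=> l; apply: le_trans (zx l) _; rewrite ler_wpM2r ?normc_ge0//.
  by rewrite /s le_max lexx.
by rewrite lee_fin ler_pdivrMr ?ltr0n// ler_pdivlMl ?ltr0n// mulrC.
Qed.

(** In one direction the filter of translated balls converges to [z] for each initial topology,
    hence for their supremum. In the other a ball is a finite intersection of preimages of metric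
    balls under the inclusions. *)
Lemma nbhs_SnuP (z : Snu nu alpha e) (U : set (Snu nu alpha e)) :
  nbhs z U <-> exists n, [set z' | B n (val z' - val z)] `<=` U.
Proof.
split.
- pose F := filter_from [set: nat]
    (fun n => [set z' : Snu nu alpha e | B n (val z' - val z)]).
  have FF : Filter F.
    apply: filter_from_filter; first by exists 0%N.
    move=> i j _ _; exists (maxn i j) => // z' zz'.
    by split; apply: le_Snu_ball zz'; rewrite ?leq_maxl ?leq_maxr.
  suff : F --> z by move=> /[apply] -[n _ nU]; exists n.
  apply/cvg_sup => -[i k] V [W [[X oX <-] Xz XV]]; rewrite nbhs_filterE.
  have : nbhs (@Snu_incl R nu alpha e i k z) X by exact: open_nbhs_nbhs.
  move=> [E [r /= r0 rE] EX].
  pose m := Num.trunc r^-1.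
  have mr : m.+1%:R^-1 <= r.
    rewrite -[leRHS]invrK lef_pV2 ?posrE ?ltr0n ?invr_gt0//.
    exact/ltW/truncnS_gt.
  exists (maxn m (maxn i k)) => // z' zz'.
  apply: XV; apply: EX; rewrite /xsection/= inE; apply: rE.
  rewrite /Espace_ball/= distB.
  apply: lt_le_trans (zz' i k _ _) _.
  - by rewrite !leq_max leqnn orbT.
  - by rewrite !leq_max leqnn !orbT.
  rewrite lee_fin; apply: le_trans mr.
  by rewrite lef_pV2 ?posrE ?ltr0n// ler_nat ltnS leq_maxl.
- move=> [n nU]; apply: (filterS nU).
  have zz : nbhs z --> z by [].
  suff /filter_forall : forall ik : 'I_n.+1 * 'I_n.+1,
      \forall z' \near z, (dist (alpha ik.1) (nu (alpha ik.1) +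
        (e ik.2)%:num%:E) (val z' - val z)%R < n.+1%:R^-1%:E)%E.
    apply: filterS => z' h i k; rewrite -ltnS => im; rewrite -ltnS => km.
    exact: (h (Ordinal im, Ordinal km)).
  move=> [i k].
  move/cvg_sup : zz => /(_ (nat_of_ord i, nat_of_ord k)) zz.
  pose f := @Snu_incl R nu alpha e i k.
  have fz : nbhs (f z) (Espace_ball (f z) n.+1%:R^-1).
    exists [set xy | Espace_ball xy.1 n.+1%:R^-1 xy.2].
      by exists n.+1%:R^-1 => //=; rewrite invr_gt0 ltr0n.
    by move=> y; rewrite /xsection/= inE.
  have := zz _ (@initial_continuous _ _ f z _ fz).
  rewrite nbhs_filterE; apply: filterS => z'.
  by rewrite /Espace_ball/= distB.
Qed.

End Snu_ball.

(** Uniform form of the membership criterion [Snu_setP]: neither [c] nor the level from which the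
    bound holds depends on [z]. *)
Definition count_bounded (R : realType) (nu : R -> \bar R)
    (A : set (Omega R)) :=
  forall a b : R, (nu a < b%:E)%E -> exists2 c, a < c &
    \forall j \near \oo, forall z, A z ->
      (card_ge z j (2 `^ (- (c * j%:R))))%:R <= 2 `^ (b * j%:R).

Definition small_head (R : realType) (m : nat) : set (Omega R) :=
  [set z | forall l, (tag l < m)%N -> nc (z l) < m.+1%:R^-1].

Lemma count_lt1 (R : realType) (n j : nat) (b : R) : b < 0 -> (0 < j)%N ->
  n%:R <= 2 `^ (b * j%:R) -> n = 0%N.
Proof.
move=> b0 j0 nb; apply/eqP; rewrite -leqn0 -ltnS -(ltr_nat R).
apply: le_lt_trans nb _; rewrite /powR pnatr_eq0/= -[ltRHS]expR0 ltr_expR.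
by rewrite pmulr_llt0 ?ln_gt0 ?ltr1n// pmulr_llt0// ltr0n.
Qed.

Lemma near_invn_le (R : realType) (r : R) : 0 < r ->
  \forall m \near \oo, m.+1%:R^-1 <= r.
Proof.
move=> r0; exists (Num.trunc r^-1) => // m /= rm.
rewrite -[leRHS]invrK lef_pV2 ?posrE ?ltr0n ?invr_gt0//.
by apply: le_trans (ltW (truncnS_gt _)) _; rewrite ler_nat ltnS.
Qed.

(** On a set with uniform counts, coordinatewise convergence to 0 implies convergence for the
    distance: the counts control all levels from some [N] on, and [small_head] controls the finitely
    many others. *)
Lemma count_bounded_dist (R : realType) (nu : R -> \bar R) (A : set (Omega R))
    (a r : R) (d : {posnum R}) : count_bounded nu A -> 0 < r ->
  \forall m \near \oo, forall z, A z -> small_head m z ->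
    (dist a (nu a + d%:num%:E) z < r%:E)%E.
Proof.
(* Half of [r], because [dist_le] yields only a weak inequality. *)
move=> Ab r0; pose s := r / 2.
have s0 : 0 < s by rewrite divr_gt0.
have sr : s < r by rewrite ltr_pdivrMr// ltr_pMr// ltr1n.
have [N hN] : exists N, forall j, (N <= j)%N -> forall z, A z ->
    ((card_ge z j (s * 2 `^ (- (a * j%:R))))%:R%:E <=
      s%:E * pow2 (nu a + d%:num%:E) j)%E.
  have tail c : a < c -> \forall j \near \oo, forall z : Omega R,
      (card_ge z j (s * 2 `^ (- (a * j%:R))) <=
       card_ge z j (2 `^ (- (c * j%:R))))%N.
    move=> ac; near=> j => z; apply: le_card_ge => k; apply: le_trans.
    rewrite -ler_pdivrMl// -!mulNr; near: j; apply: le_powR_near.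
    by rewrite ltrN2.
  case E : (nu a) => [v| |].
  - have [|c ac cA] := Ab a (v + d%:num / 2).
      by rewrite E lte_fin ltrDl.
    suff [N _ hN] : \forall j \near \oo, forall z, A z ->
      ((card_ge z j (s * 2 `^ (- (a * j%:R))))%:R%:E <=
      s%:E * pow2 (v%:E + d%:num%:E) j)%E by exists N.
    near=> j => z Az; rewrite /= lee_fin.
    apply: (@le_trans _ _ (card_ge z j (2 `^ (- (c * j%:R))))%:R).
      by rewrite ler_nat; move: (z); near: j; exact: tail.
    apply: (@le_trans _ _ (2 `^ ((v + d%:num / 2) * j%:R))).
      by move: Az; move: (z); near: j.
    rewrite -ler_pdivrMl//; near: j; apply: le_powR_near.
    by rewrite ltrD2l ltr_pdivrMr// ltr_pMr// ltr1n.
  - by exists 0%N => j _ z _; rewrite addye//= gt0_muley ?lte_fin// leey.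
  (* Here no index at all is allowed above the threshold; the bound [2 ^ (- j)] forces an integer
     count to be 0 once [j > 0]. *)
  - have [|c ac cA] := Ab a (-1); first by rewrite E ltNyr.
    suff [N _ hN] : \forall j \near \oo, forall z, A z ->
      card_ge z j (s * 2 `^ (- (a * j%:R))) = 0%N.
      by exists N => j Nj z Az; rewrite hN// mule_ge0 ?pow2_ge0// lee_fin ltW.
    near=> j => z Az.
    apply/eqP; rewrite -leqn0.
    apply: (@leq_trans (card_ge z j (2 `^ (- (c * j%:R))))).
      by move: (z); near: j; exact: tail.
    rewrite leqn0; apply/eqP; apply: (@count_lt1 R _ j (-1)).
    + by rewrite oppr_lt0 ltr01.
    + by near: j; exists 1%N.
    + by move: Az; move: (z); near: j.
near=> m => z Az zm; apply: le_lt_trans (_ : _ <= s%:E)%E _; last first.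
  by rewrite lte_fin.
apply: dist_le; first exact: ltW.
move=> j; have [jN|Nj] := ltnP j N; last exact: hN.
rewrite card_ge_eq0 => [|k].
  by rewrite mule_ge0 ?pow2_ge0// lee_fin ltW.
apply: (@lt_le_trans _ _ m.+1%:R^-1).
  apply: zm => /=; apply: leq_trans jN _.
  by near: m; exists N.
(* A common lower bound for the thresholds of all levels below [N], whatever the sign of [a]. *)
apply: (@le_trans _ _ (s * 2 `^ (- (`|a| * N%:R)))).
  by near: m; apply: near_invn_le; rewrite mulr_gt0 ?powR_gt0.
rewrite ler_pM2l// ler_powR ?ler1n// lerN2.
apply: (@le_trans _ _ (`|a| * j%:R)); first by rewrite ler_wpM2r// ler_norm.
by rewrite ler_wpM2l// ler_nat ltnW.
Unshelve. all: by end_near. Qed.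

Lemma count_bounded_ball (R : realType) (nu : R -> \bar R) alpha e A n :
  count_bounded nu A ->
  exists m, forall z, A z -> small_head m z -> Snu_ball nu alpha e n z.
Proof.
move=> Ab.
have /filter_forall[N _ /(_ N (leqnn N)) h] : forall ik : 'I_n.+1 * 'I_n.+1,
    \forall m \near \oo, forall z, A z -> small_head m z ->
      (dist (alpha ik.1) (nu (alpha ik.1) + (e ik.2)%:num%:E) z
        < n.+1%:R^-1%:E)%E.
  by move=> ik; apply: count_bounded_dist => //; rewrite invr_gt0 ltr0n.
exists N => z Az zN i k; rewrite -ltnS => im; rewrite -ltnS => km.
exact: (h (Ordinal im, Ordinal km)).
Qed.

Lemma Snu_count_bounded (R : realType) (nu : R -> \bar R) x : Snu_set nu x ->
  count_bounded nu [set z | forall l, nc (z l) <= nc (x l)].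
Proof.
move=> /Snu_setP xS a b /xS[f f0 xf]; exists (a + f); first by rewrite ltrDl.
apply: filterS xf => j h z zx; apply: le_trans h; rewrite ler_nat.
by apply: le_card_ge => k /le_trans; apply.
Qed.

Lemma Omega_subE (R : realType) (x z : Omega R) l : (x - z) l = x l - z l.
Proof. by []. Qed.

Definition truncate (R : realType) (J : nat) (x : Omega R) : Omega R :=
  fun l => if (tag l < J)%N then x l else 0.

Definition finitely_supported (R : realType) : set (Omega R) :=
  [set x | exists J, truncate J x = x].

Lemma truncateP (R : realType) J (x : Omega R) :
  finitely_supported (truncate J x).
Proof.
by exists J; apply/funext => l; rewrite /truncate; case: (tag l < J)%N.
Qed.

Lemma finite_Snu (R : realType) (nu : R -> \bar R) x :
  finitely_supported x -> Snu_set nu x.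
Proof.
move=> [J xJ]; apply/Snu_setP => a b _; exists 1 => //.
exists J => // j /= Jj; rewrite card_ge_eq0 ?powR_ge0// => k.
have -> : x (lam k) = 0 by rewrite -xJ /truncate/= ltnNge Jj.
by rewrite Normc.normc0 powR_gt0.
Qed.

Lemma head_bound (R : realType) (x : Omega R) (m : nat) :
  exists2 M : R, 0 < M & forall l, (tag l < m)%N -> nc (x l) < M.
Proof.
pose F j := \sum_(k < 2 ^ j) nc (x (lam k)).
have F0 j : 0 <= F j by apply: sumr_ge0 => k _; exact: normc_ge0.
exists (1 + \sum_(j < m) F j); first by rewrite ltr_pwDl// sumr_ge0.
move=> [j k] /= jm; rewrite -[nc _]add0r ltr_leD//.
rewrite (bigD1 (Ordinal jm))//= -[leLHS]addr0 lerD ?sumr_ge0//.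
by rewrite /F (bigD1 k)//= lerDl sumr_ge0// => i _; exact: normc_ge0.
Qed.

Section absorb.
Context {R : realType} (nu : R -> \bar R) (alpha : nat -> R).
Variable e : nat -> {posnum R}.
Local Notation B := (Snu_ball nu alpha e).
Implicit Types x z : Omega R.

Lemma Snu_ball_truncate x n : Snu_set nu x ->
  exists J, B n (x - truncate J x).
Proof.
move=> /Snu_count_bounded/(@count_bounded_ball _ _ alpha e _ n)[J h].
exists J; apply: h => l /=; rewrite /truncate/=.
  rewrite Omega_subE; case: ifP => _; rewrite ?subr0//.
  by rewrite subrr Normc.normc0 normc_ge0.
move=> lJ; rewrite Omega_subE lJ subrr Normc.normc0.
by rewrite invr_gt0 ltr0n.
Qed.

(** The sequences dominated by [x] have uniform counts, so it suffices that [t] make the finitely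
    many coordinates of the head small. *)
Lemma Snu_ball_absorb x n : Snu_set nu x ->
  exists2 t : R, 0 < t &
    forall z, (forall l, nc (z l) <= t * nc (x l)) -> B n z.
Proof.
move=> /Snu_count_bounded/(@count_bounded_ball _ _ alpha e _ n)[J h].
have [M M0 xM] := head_bound x J.
exists (Num.min 1 (J.+1%:R^-1 / M)).
  by rewrite lt_min ltr01 divr_gt0// invr_gt0 ltr0n.
move=> z zx; apply: h => l /=.
  apply: le_trans (zx l) _; rewrite ler_piMl ?normc_ge0//.
  by rewrite ge_min lexx.
move=> lJ; apply: le_lt_trans (zx l) _.
apply: (@le_lt_trans _ _ (J.+1%:R^-1 / M * nc (x l))).
  by rewrite ler_wpM2r ?normc_ge0// ge_min lexx orbT.
by rewrite -mulrA gtr_pMr ?invr_gt0 ?ltr0n// ltr_pdivrMl// mulr1 xM.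
Qed.

End absorb.

(** * The estimate of the pairing *)

Lemma big_uniq_sub (V : nmodType) (I : eqType) (s t : seq I) (f : I -> V) :
  uniq s -> uniq t -> {subset s <= t} ->
  \sum_(l <- t) f l = \sum_(l <- s) f l + \sum_(l <- t | l \notin s) f l.
Proof.
move=> us ut st; rewrite (bigID (mem s))/=; congr (_ + _).
rewrite -big_filter; apply: perm_big; apply: uniq_perm => //.
  exact: filter_uniq.
by move=> l; rewrite mem_filter andb_idr//; exact: st.
Qed.

Lemma ler_sum_uniq_sub (R : numDomainType) (I : eqType) (s t : seq I)
    (f : I -> R) : (forall l, 0 <= f l) ->
  uniq s -> uniq t -> {subset s <= t} ->
  \sum_(l <- s) f l <= \sum_(l <- t) f l.
Proof.
by move=> f0 us ut st; rewrite (big_uniq_sub f us ut st) lerDl sumr_ge0.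
Qed.

Lemma big_uniq_support (V : nmodType) (I : eqType) (s t : seq I) (f : I -> V) :
  uniq s -> uniq t -> {subset s <= t} -> (forall l, l \notin s -> f l = 0) ->
  \sum_(l <- t) f l = \sum_(l <- s) f l.
Proof.
move=> us ut st f0.
by rewrite (big_uniq_sub f us ut st) [X in _ + X]big1 ?addr0.
Qed.

Definition levels (J : nat) : seq Lambda :=
  [seq lam k | j <- iota 0 J, k <- enum 'I_(2 ^ j)].

Lemma levels_uniq J : uniq (levels J).
Proof.
apply: allpairs_uniq_dep; first exact: iota_uniq.
  by move=> j _; exact: enum_uniq.
by move=> [j k] [j' k'] _ _ /=; rewrite /lam /Tagged.
Qed.

Lemma mem_levels J l : (l \in levels J) = (tag l < J)%N.
Proof.
apply/idP/idP => [/allpairsPdep[j [k [+ _ ->]]]|].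
  by rewrite mem_iota.
case: l => j k /= jJ; apply/allpairsPdep; exists j, k.
by rewrite mem_enum mem_iota/= add0n.
Qed.

Lemma big_levels (V : nmodType) J (f : Lambda -> V) :
  \sum_(l <- levels J) f l = \sum_(0 <= j < J) \sum_(k < 2 ^ j) f (lam k).
Proof.
rewrite /levels big_allpairs_dep/= /index_iota subn0.
by apply: eq_bigr => j _; rewrite big_enum.
Qed.

Lemma sub_levels (s : seq Lambda) : exists J, {subset s <= levels J}.
Proof.
exists (\max_(l <- s) (tag l).+1)%N => l ls; rewrite mem_levels.
exact: (@leq_bigmax_seq _ s xpredT (fun l : Lambda => (tag l).+1) _ ls isT).
Qed.

Lemma geometric_sum_le (R : realType) (q : R) J : 0 <= q < 1 ->
  \sum_(0 <= j < J) q ^+ j <= (1 - q)^-1.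
Proof.
move=> /andP[q0 q1]; have q1' : 0 < 1 - q by rewrite subr_gt0.
rewrite big_mkord -(ler_pM2l q1') mulfV ?gt_eqF// -opprB mulNr.
by rewrite -subrX1 opprB gerBl exprn_ge0.
Qed.

Lemma clip_le (R : realType) (b : \bar R) : (clip b <= b)%E.
Proof. by rewrite /clip; case: ifP => _; rewrite ?leNye// ge_min lexx. Qed.

(** If the first alternative fails, then [a] belongs to the set whose infimum defines the dual
    profile at [a'], and clipping never increases a value. *)
Lemma dual_profile_min (R : realType) (nu : R -> \bar R) (a a' : R) :
  (nu a <= (a + a')%:E)%E \/ (dual_profile nu a' <= (a + a')%:E)%E.
Proof.
have [h|h] := leP (nu a - a%:E)%E a'%:E.
  by left; rewrite EFinD addeC -leeBlDr.
right; apply: le_trans (clip_le _) _.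
by rewrite [(a + a')%R]addrC EFinD leeD2l//; apply: ereal_inf_lbound; exists a.
Qed.

Lemma pow2_le (R : realType) (b : \bar R) (c : R) j :
  (b <= c%:E)%E -> (pow2 b j <= (2 `^ (c * j%:R))%:E)%E.
Proof.
case: b => [r| |]//= bc; rewrite lee_fin ?powR_ge0//.
by rewrite ler_powR ?ler1n// ler_wpM2r// -lee_fin.
Qed.

(** Density puts some [alpha i] between [a] and [a + h]; by monotonicity [mu (alpha i) + e k] is
    then at most [b] for a suitable [k]. *)
Lemma Snu_ball_count (R : realType) (mu : R -> \bar R) (alpha : nat -> R)
    (e : nat -> {posnum R}) (a h b : R) :
  dense (range alpha) -> (e m)%:num @[m --> \oo] --> (0 : R) ->
  {homo mu : u v / u <= v >-> (u <= v)%E} ->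
  0 < h -> (mu (a + h)%R < b%:E)%E ->
  exists n, forall x, Snu_ball mu alpha e n x -> forall j,
    (card_ge x j (2 `^ (- (a * j%:R))))%:R * 2 <= 2 `^ (b * j%:R).
Proof.
move=> ad e0 mu_homo h0 /lt_fin_dense[c muc cb].
have [_ [] /[swap] [[i _ <-]]] : (`]a, (a + h)[ `&` range alpha) !=set0.
  apply: ad; last exact: interval_open.
  by exists (a + h / 2); rewrite /= in_itv/= ltrDl ltrD2l divr_gt0//=
    ltr_pdivrMr// ltr_pMr// ltr1n.
rewrite /= in_itv/= => /andP[ai ih].
have bc0 : 0 < b - c by rewrite subr_gt0.
move/cvgrPdist_lt : e0 => /(_ _ bc0)[k _ /(_ k (leqnn k))].
rewrite sub0r normrN gtr0_norm// => ek.
(* The 1 keeps the radius at most one half, which gives the factor 2 of the conclusion. *)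
exists (maxn 1 (maxn i k)) => x xB j; set n := maxn 1 _ in xB.
have n1 : n.+1%:R^-1 <= 2^-1 :> R.
  by rewrite lef_pV2 ?posrE ?ltr0n// ler_nat ltnS leq_maxl.
have := fun im km => dist_lt_card j (xB i k im km).
rewrite !leq_max !leqnn !orbT => /(_ isT isT) xj.
rewrite -ler_pdivlMr// -lee_fin; apply: le_trans (le_trans xj _).
  rewrite lee_fin ler_nat; apply: le_card_ge => l; apply: le_trans.
  apply: (@le_trans _ _ (1 * 2 `^ (- (alpha i * j%:R)))).
    by rewrite ler_wpM2r ?powR_ge0// (le_trans n1)// invf_le1 ?ler1n.
  by rewrite mul1r ler_powR ?ler1n// lerN2 ler_wpM2r// ltW.
rewrite [(_ / 2)%R]mulrC EFinM lee_pmul// ?lee_fin//; first exact: pow2_ge0.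
apply: pow2_le.
apply: (@le_trans _ _ (c%:E + (b - c)%:E)%E); last first.
  by rewrite -EFinD addrC subrK.
apply: leeD; last by rewrite lee_fin ltW.
by apply: le_trans (ltW muc); exact/mu_homo/ltW.
Qed.

(** With [b = 0] the factor 2 of [Snu_ball_count] excludes even a single index, at level 0 as
    well. *)
Lemma Snu_ball_lt (R : realType) (mu : R -> \bar R) (alpha : nat -> R)
    (e : nat -> {posnum R}) (a h : R) :
  dense (range alpha) -> (e m)%:num @[m --> \oo] --> (0 : R) ->
  {homo mu : u v / u <= v >-> (u <= v)%E} ->
  0 < h -> (mu (a + h)%R < 0)%E ->
  exists n, forall x, Snu_ball mu alpha e n x -> forall j (k : 'I_(2 ^ j)),
    nc (x (lam k)) < 2 `^ (- (a * j%:R)).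
Proof.
move=> ad e0 muh h0 /(Snu_ball_count ad e0 muh h0)[n xB].
exists n => x /xB{}xB j k; rewrite ltNge; apply/negP => xk.
have := xB j; rewrite mul0r powRr0 -natrM; apply/negP; rewrite -ltNge ltr1n.
suff : (0 < card_ge x j (2 `^ (- (a * j%:R))))%N by lia.
by apply/card_gt0P; exists k; rewrite inE.
Qed.

(** Both logarithmic scales are cut into [N] steps of length [h]. Either one factor lies below the
    last step, or both lie in a cell [(i, i')], where the product is at most that of the upper
    ends. *)
Lemma product_grid (R : realType) (j N : nat) (A A' h X Y : R) :
  0 <= X < 2 `^ (- (A * j%:R)) -> 0 <= Y < 2 `^ (- (A' * j%:R)) ->
  X * Y <= 2 * 2 `^ (- ((A + A' + N%:R * h) * j%:R)) +
    \sum_(i < N) \sum_(i' < N)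
      (if (2 `^ (- ((A + i.+1%:R * h) * j%:R)) <= X) &&
          (2 `^ (- ((A' + i'.+1%:R * h) * j%:R)) <= Y)
       then 2 `^ (- ((A + i%:R * h + (A' + i'%:R * h)) * j%:R)) else 0).
Proof.
have P2 (u v : R) : 2 `^ (- (u * j%:R)) * 2 `^ (- (v * j%:R)) =
    2 `^ (- ((u + v) * j%:R)) :> R.
  by rewrite -powRD ?pnatr_eq0 ?implybT// -opprD -mulrDl.
move=> /andP[X0 XA] /andP[Y0 YA].
set S := \sum_(i < N) _; set T := 2 `^ (- ((A + A' + N%:R * h) * j%:R)).
have S0 : 0 <= S.
  apply: sumr_ge0 => i _; apply: sumr_ge0 => i' _.
  by case: ifP; rewrite ?powR_ge0.
have T0 : 0 <= T by rewrite powR_ge0.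
have [XN|NX] := ltP X (2 `^ (- ((A + N%:R * h) * j%:R))).
  apply: (@le_trans _ _ T); last first.
    by rewrite mulr_natl mulr2n -addrA lerDl addr_ge0.
  by rewrite /T addrAC -P2 ler_pM// ltW.
have [YN|NY] := ltP Y (2 `^ (- ((A' + N%:R * h) * j%:R))).
  apply: (@le_trans _ _ T); last first.
    by rewrite mulr_natl mulr2n -addrA lerDl addr_ge0.
  by rewrite /T -addrA -P2 ler_pM// ltW.
have level (C Z : R) : Z < 2 `^ (- (C * j%:R)) ->
    2 `^ (- ((C + N%:R * h) * j%:R)) <= Z ->
    exists i : 'I_N, Z < 2 `^ (- ((C + i%:R * h) * j%:R)) /\
                 2 `^ (- ((C + i.+1%:R * h) * j%:R)) <= Z.
  move=> ZC CZ.
  (* The least step whose threshold is at most [Z]; it is not step 0, because [Z] is below that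
     threshold. *)
  have := @ex_minnP (fun n => 2 `^ (- ((C + n%:R * h) * j%:R)) <= Z).
  move=> /(_ (ex_intro _ N CZ))[[|n] nZ nmin].
    by move: nZ; rewrite mul0r addr0 leNgt ZC.
  exists (Ordinal (nmin _ CZ)); split => //=.
  by rewrite ltNge; apply/negP => /nmin; rewrite ltnn.
have [i [Xi iX]] := level _ _ XA NX.
have [i' [Yi iY]] := level _ _ YA NY.
apply: (@le_trans _ _ S); last by rewrite lerDr mulr_ge0.
rewrite /S (bigD1 i)//= (bigD1 i')//= iX iY/= -P2.
rewrite -addrA -[leLHS]addr0 lerD//; first by rewrite ler_pM// ltW.
rewrite addr_ge0//.
  by apply: sumr_ge0 => k _; case: ifP; rewrite ?powR_ge0.
apply: sumr_ge0 => k _; apply: sumr_ge0 => k' _.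
by case: ifP; rewrite ?powR_ge0.
Qed.

Section pairing_bound.
Context {R : realType} (nu : R -> \bar R) (alpha : nat -> R).
Variable e : nat -> {posnum R}.
Hypothesis alpha_dense : dense (range alpha).
Hypothesis e_cvg0 : (e m)%:num @[m --> \oo] --> (0 : R).
Hypothesis nu_homo : {homo nu : u v / u <= v >-> (u <= v)%E}.
Implicit Types x y : Omega R.

Let mu eps := shift_profile (dual_profile nu) eps.

Let mu_homo eps : {homo (mu eps) : u v / u <= v >-> (u <= v)%E}.
Proof. by move=> u v uv; apply: dual_profile_homo; rewrite lerD2r. Qed.

(** By [dual_profile_min] at [a + h] and [a' + h - eps], one of the two counts alone is small
    enough. Two of the three [h] pay for the shifts to the right in [Snu_ball_count], the third for
    its strict inequality. *)
Lemma pair_count eps a a' h : 0 < h -> exists n, forall x y,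
  Snu_ball nu alpha e n x -> Snu_ball (mu eps) alpha e n y -> forall j,
  #|[pred k : 'I_(2 ^ j) | (2 `^ (- (a * j%:R)) <= nc (x (lam k))) &&
                           (2 `^ (- (a' * j%:R)) <= nc (y (lam k)))]|%:R
  <= 2 `^ ((a + a' + 3 * h - eps) * j%:R) :> R.
Proof.
move=> h0; set b := a + a' + 3 * h - eps.
have lt_b : ((a + h + (a' + h - eps))%:E < b%:E)%E by rewrite lte_fin /b; lra.
have half (u v : R) : u * 2 <= v -> 0 <= u -> u <= v by lra.
have [le_b|le_b] := dual_profile_min nu (a + h) (a' + h - eps).
- have [n hn] := Snu_ball_count alpha_dense e_cvg0 nu_homo h0
    (le_lt_trans le_b lt_b).
  exists n => x y /hn{}hn _ j; apply: le_trans (half _ _ (hn j) _) => //.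
  rewrite ler_nat; apply: subset_leq_card; apply/fintype.subsetP => k.
  by rewrite !inE => /andP[].
- have [n hn] := Snu_ball_count alpha_dense e_cvg0 (@mu_homo eps) h0
    (le_lt_trans le_b lt_b).
  exists n => x y _ /hn{}hn j; apply: le_trans (half _ _ (hn j) _) => //.
  rewrite ler_nat; apply: subset_leq_card; apply/fintype.subsetP => k.
  by rewrite !inE => /andP[].
Qed.

Lemma pairing_bound eps : 0 < eps ->
  (exists a, (nu a < 0)%E) -> (exists a, (0 <= nu a)%E) ->
  exists n K, forall x y,
    Snu_ball nu alpha e n x -> Snu_ball (mu eps) alpha e n y ->
    forall s : seq Lambda, uniq s -> \sum_(l <- s) nc (x l) * nc (y l) <= K.
Proof.
move=> eps0 [a0 a0_lt0] [a1 a1_ge0].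
(* A cell loses [2 * h] between its lower and upper ends and [3 * h] in [pair_count]; with
   [eps = 6 * h] the exponent [- h] remains. *)
pose h := eps / 6; have h0 : 0 < h by rewrite divr_gt0.
(* As [nu a0 < 0], the coordinates of [x] stay below [2 ^ (- A j)]. As [0 <= nu a1],
   [dual_profile_min] makes the dual profile at most [- h] at [A' + h - eps], so those of [y] stay
   below [2 ^ (- A' j)]. *)
pose A := a0 - h; pose A' := eps - a1 - 2 * h.
have [nA hA] : exists n, forall x, Snu_ball nu alpha e n x ->
    forall j (k : 'I_(2 ^ j)), nc (x (lam k)) < 2 `^ (- (A * j%:R)).
  apply: (Snu_ball_lt alpha_dense e_cvg0 nu_homo h0).
  by rewrite /A subrK.
have [nA' hA'] : exists n, forall x, Snu_ball (mu eps) alpha e n x ->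
    forall j (k : 'I_(2 ^ j)), nc (x (lam k)) < 2 `^ (- (A' * j%:R)).
  apply: (Snu_ball_lt alpha_dense e_cvg0 (@mu_homo eps) h0).
  rewrite /mu/shift_profile.
  have := dual_profile_min nu a1 (A' + h - eps).
  have lt0 : ((a1 + (A' + h - eps))%:E < 0)%E by rewrite lte_fin /A'; lra.
  move=> [|/le_lt_trans]; last exact.
  by move=> /le_lt_trans/(_ lt0); rewrite ltNge a1_ge0.
(* So many steps that even [2 ^ j] products of size [2 ^ (- (A + A' + N h) j)] sum to at most
   [2 ^ (- h j)]. *)
pose N := (Num.trunc ((1 + h - A - A') / h)).+1.
have Nh : 1 + h - A - A' <= N%:R * h.
  by rewrite -ler_pdivrMr//; exact/ltW/truncnS_gt.
have /choice[n hn] : forall ii : 'I_N * 'I_N, exists n, forall x y,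
    Snu_ball nu alpha e n x -> Snu_ball (mu eps) alpha e n y -> forall j,
    #|[pred k : 'I_(2 ^ j) |
       (2 `^ (- ((A + ii.1.+1%:R * h) * j%:R)) <= nc (x (lam k))) &&
       (2 `^ (- ((A' + ii.2.+1%:R * h) * j%:R)) <= nc (y (lam k)))]|%:R
    <= 2 `^ ((A + ii.1.+1%:R * h + (A' + ii.2.+1%:R * h) + 3 * h - eps)
             * j%:R) :> R.
  by move=> ii; exact: pair_count.
pose m := maxn (maxn nA nA') (\max_ii n ii)%N.
pose q : R := 2 `^ (- h).
have q01 : 0 <= q < 1.
  rewrite powR_ge0 /q /powR pnatr_eq0/= -[ltRHS]expR0 ltr_expR.
  by rewrite pmulr_llt0 ?oppr_lt0// ln_gt0// ltr1n.
have qE j : q ^+ j = 2 `^ (- h * j%:R) by rewrite powRrM powR_mulrn ?powR_ge0.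
exists m, ((2 + N%:R * N%:R) * (1 - q)^-1) => x y xm ym.
move=> s us; have [J sJ] := sub_levels s.
apply: le_trans (ler_sum_uniq_sub _ us (levels_uniq J) sJ) _ => [l|].
  by rewrite mulr_ge0 ?normc_ge0.
rewrite big_levels.
have NN0 : 0 <= 2 + N%:R * N%:R :> R by rewrite addr_ge0// mulr_ge0.
apply: (@le_trans _ _ (\sum_(0 <= j < J) (2 + N%:R * N%:R) * q ^+ j));
  last first.
  by rewrite -mulr_sumr ler_wpM2l// geometric_sum_le.
apply: ler_sum => j _.
have xA k : 0 <= nc (x (@lam j k)) < 2 `^ (- (A * j%:R)).
  rewrite normc_ge0/=; apply: hA; apply: le_Snu_ball xm.
  by rewrite /m !leq_max leqnn.
have yA k : 0 <= nc (y (@lam j k)) < 2 `^ (- (A' * j%:R)).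
  rewrite normc_ge0/=; apply: hA'; apply: le_Snu_ball ym.
  by rewrite /m !leq_max leqnn !orbT.
apply: le_trans (ler_sum _ (fun k _ => product_grid N h (xA k) (yA k))) _.
rewrite big_split/= [leRHS]mulrDl lerD//.
  rewrite sumr_const card_ord -[leLHS]mulr_natl [leLHS]mulrCA ler_pM2l// qE.
  rewrite natrX -powR_mulrn// -powRD ?pnatr_eq0 ?implybT//.
  rewrite ler_powR ?ler1n// -[X in X + _]mul1r -mulrBl ler_wpM2r//.
  by lra.
have -> : N%:R * N%:R * q ^+ j = \sum_(i < N) \sum_(i' < N) q ^+ j.
  by rewrite !sumr_const !card_ord -mulrnA -[RHS]mulr_natl natrM.
rewrite exchange_big/=; apply: ler_sum => i _.
rewrite exchange_big/=; apply: ler_sum => i' _.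
rewrite -big_mkcond/= sumr_const.
have nm : (n (i, i') <= m)%N.
  by rewrite /m leq_max; apply/orP; right; exact: leq_bigmax.
have /= := hn (i, i') x y (le_Snu_ball nm xm) (le_Snu_ball nm ym) j.
move=> hc; rewrite -[leLHS]mulr_natl.
apply: le_trans (ler_wpM2r (powR_ge0 _ _) (le_trans _ hc)) _.
  by rewrite ler_nat; apply: eq_leq; apply: eq_card => k; rewrite !inE.
rewrite -powRD ?pnatr_eq0 ?implybT// -mulNr -mulrDl qE.
rewrite ler_powR ?ler1n// ler_wpM2r//.
have epsE : eps = 6 * h by rewrite /h mulrC divfK.
rewrite -[i.+1%:R]natr1 -[i'.+1%:R]natr1 epsE; lra.
Qed.

End pairing_bound.

(** * Moduli of complex numbers *)

Lemma norm_normc (R : rcfType) (z : R[i]) : `|z| = (nc z)%:C%C.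
Proof. by case: z. Qed.

Lemma normc_conj (R : rcfType) (z : R[i]) : nc z^* = nc z.
Proof.
by apply: (@complexI R); rewrite -!norm_normc norm_conjC.
Qed.

Lemma normc_real (R : rcfType) (t : R) : nc (t%:C%C) = `|t|.
Proof. by rewrite /Normc.normc/= expr0n addr0 sqrtr_sqr. Qed.

Lemma cvg_normcP (R : realType) (T : Type) (F : set_system T) (FF : Filter F)
    (f : T -> R[i]^o) (L : R[i]^o) :
  f @ F --> L <-> forall r : R, 0 < r -> \forall x \near F, nc (L - f x) < r.
Proof.
split=> [/cvgrPdist_lt h r r0|h].
  have /h : 0 < r%:C%C by rewrite ltcE/= eqxx.
  by apply: filterS => x; rewrite norm_normc ltcR.
apply/cvgrPdist_lt => -[a b] /=; rewrite ltcE/= => /andP[/eqP -> a0].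
by apply: filterS (h a a0) => x; rewrite norm_normc -ltcR.
Qed.

(** * The pairing *)

Lemma partial_sumE (I : choiceType) (V : zmodType) (z : I -> V)
    (A : finmap.finset_of (Phant I)) :
  summability.partial_sum z A = \sum_(l <- finmap.enum_fset A) z l.
Proof. by rewrite finmap.big_seq_fsetE. Qed.

#[local] Existing Instance summability.totally_filter.

Lemma normr_Re_le (R : rcfType) (z : R[i]) : `|complex.Re z| <= nc z.
Proof.
by case: z => a b /=; rewrite -sqrtr_sqr ler_wsqrtr// lerDl sqr_ge0.
Qed.

Lemma normr_Im_le (R : rcfType) (z : R[i]) : `|complex.Im z| <= nc z.
Proof.
by case: z => a b /=; rewrite -sqrtr_sqr ler_wsqrtr// lerDr sqr_ge0.
Qed.

Lemma normc_inv2 (R : rcfType) : nc (2^-1 : R[i]) = 2^-1.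
Proof.
have -> : (2 : R[i]) = (2 : R)%:C%C by rewrite rmorph_nat.
by rewrite Normc.normcV normc_real ger0_norm.
Qed.

Lemma normc_le_ReIm (R : rcfType) (z : R[i]) :
  nc z <= `|complex.Re z| + `|complex.Im z|.
Proof.
case: z => a b /=.
have -> : `|a| + `|b| = Num.sqrt ((`|a| + `|b|) ^+ 2).
  by rewrite sqrtr_sqr [RHS]ger0_norm ?addr_ge0.
rewrite ler_wsqrtr// sqrrD !real_normK ?num_real// addrAC lerDl.
by rewrite mulrn_wge0// mulr_ge0.
Qed.

(** * Absolutely summable families *)

Section absolute_summability.
Context {R : realType} {I : choiceType}.

Lemma cvg_partial_sum_ge0 (u : I -> R) (K : R) : (forall l, 0 <= u l) ->
  (forall s, uniq s -> \sum_(l <- s) u l <= K) ->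
  cvg (summability.partial_sum u @ summability.totally).
Proof.
move=> u0 uK; pose S := [set \sum_(l <- s) u l | s in [set s : seq I | uniq s]].
have supS : has_sup S.
  split; first by exists (\sum_(l <- [::]) u l); exists [::].
  by exists K => _ [s us <-]; exact: uK.
apply/cvg_ex; exists (sup S); apply/cvgrPdist_lt => r r0.
have [_ [s us <-] hs] := sup_adherent r0 supS.
exists (finmap.seq_fset tt s) => // B sB.
rewrite !partial_sumE.
rewrite ger0_norm; last first.
  rewrite subr_ge0 (ub_le_sup supS.2)//.
  exists (finmap.enum_fset B) => //=; exact: finmap.fset_uniq.
rewrite ltrBlDr -ltrBlDl; apply: lt_le_trans hs _.
apply: ler_sum_uniq_sub => // l ls.
by move/finmap.fsubsetP : sB; apply; rewrite finmap.seq_fsetE.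
Qed.

Lemma cvg_partial_sum (z : I -> R[i]^o) (K : R) :
  (forall s, uniq s -> \sum_(l <- s) nc (z l) <= K) ->
  cvg (summability.partial_sum z @ summability.totally).
Proof.
move=> zK.
have leK (u : I -> R) : (forall l, u l <= nc (z l) *+ 2) ->
    forall s, uniq s -> \sum_(l <- s) u l <= K *+ 2.
  move=> uz s us; apply: (@le_trans _ _ (\sum_(l <- s) nc (z l) *+ 2)).
    exact: ler_sum.
  by rewrite sumrMnl lerMn2r zK.
have re l := normr_Re_le (z l); have im l := normr_Im_le (z l).
have /cvg_ex[/= L0 cvg0] := @cvg_partial_sum_ge0 (fun l => nc (z l)) K
  (fun l => normc_ge0 _) zK.
have /cvg_ex[/= L1 cvg1] : cvg (summability.partial_sum
    (fun l => nc (z l) + complex.Re (z l)) @ summability.totally).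
  apply: (@cvg_partial_sum_ge0 _ (K *+ 2)) => [l|].
    by have := re l; rewrite ler_norml => /andP[]; lra.
  by apply: leK => l; rewrite mulr2n lerD2l (le_trans (ler_norm _)).
have /cvg_ex[/= L2 cvg2] : cvg (summability.partial_sum
    (fun l => nc (z l) + complex.Im (z l)) @ summability.totally).
  apply: (@cvg_partial_sum_ge0 _ (K *+ 2)) => [l|].
    by have := im l; rewrite ler_norml => /andP[]; lra.
  by apply: leK => l; rewrite mulr2n lerD2l (le_trans (ler_norm _)).
(* The nonnegative families [nc z], [nc z + Re z] and [nc z + Im z] converge by
   monotonicity, and [z] is a combination of them. *)
apply/cvg_ex; exists (Complex (L1 - L0) (L2 - L0)).
apply/cvg_normcP => r r0.
have r4 : 0 < r / 4 by rewrite divr_gt0.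
move/cvgrPdist_lt : cvg0 => /(_ _ r4) cvg0.
move/cvgrPdist_lt : cvg1 => /(_ _ r4) cvg1.
move/cvgrPdist_lt : cvg2 => /(_ _ r4) cvg2.
near=> A.
have -> : summability.partial_sum z A =
    Complex (summability.partial_sum (fun l => nc (z l) + complex.Re (z l)) A -
             summability.partial_sum (fun l => nc (z l)) A)
            (summability.partial_sum (fun l => nc (z l) + complex.Im (z l)) A -
             summability.partial_sum (fun l => nc (z l)) A).
  rewrite !partial_sumE; elim: (finmap.enum_fset A) => [|l s IH].
    by rewrite !big_nil subrr.
  rewrite !big_cons IH; case: (z l) => a b /=.
  by apply/eqP; rewrite eq_complex /=; apply/andP; split; apply/eqP; ring.
have h0 : `|L0 - summability.partial_sum (fun l => nc (z l)) A| < r / 4.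
  by near: A.
have h1 : `|L1 - summability.partial_sum
  (fun l => nc (z l) + complex.Re (z l)) A| < r / 4 by near: A.
have h2 : `|L2 - summability.partial_sum
  (fun l => nc (z l) + complex.Im (z l)) A| < r / 4 by near: A.
move: h0 h1 h2.
move: (summability.partial_sum (fun l => nc (z l)) A)
      (summability.partial_sum (fun l => nc (z l) + complex.Re (z l)) A)
      (summability.partial_sum (fun l => nc (z l) + complex.Im (z l)) A).
move=> p0 p1 p2 h0 h1 h2.
apply: le_lt_trans (normc_le_ReIm _) _ => /=.
rewrite (_ : L1 - L0 - _ = (L1 - p1) - (L0 - p0)); last by ring.
rewrite (_ : L2 - L0 - _ = (L2 - p2) - (L0 - p0)); last by ring.
apply: le_lt_trans (lerD (ler_normB _ _) (ler_normB _ _)) _.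
lra.
Unshelve. all: by end_near. Qed.

Lemma lim_partial_sum_le (z : I -> R[i]^o) (K : R) :
  (forall s, uniq s -> \sum_(l <- s) nc (z l) <= K) ->
  nc (lim (summability.partial_sum z @ summability.totally)) <= K.
Proof.
move=> zK; have /cvg_normcP zL := cvg_partial_sum zK.
apply/ler_addgt0Pr => r r0.
have [A /ltW hA] := filter_ex (zL r r0).
rewrite -[X in nc X](subrK (summability.partial_sum z A)) addrC.
apply: le_trans (le_normcD _ _) _; apply: lerD => //.
rewrite !partial_sumE.
apply: le_trans (zK _ (finmap.fset_uniq A)).
elim/big_rec2 : _ => [|l u v _ uv]; first by rewrite Normc.normc0.
by apply: le_trans (le_normcD _ _) _; rewrite lerD2l.
Qed.

End absolute_summability.

Definition head_pairing (R : realType) (J : nat) (x y : Omega R) : R[i]^o :=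
  \sum_(l <- levels J) pairing_terms x y l.

Section pairing.
Context {R : realType}.
Implicit Types x y : Omega R.

(** A bound on all finite partial sums gives absolute summability of the terms and bounds the
    pairing by the same [K]. *)
Definition dominated x y (K : R) := forall s : seq Lambda, uniq s ->
  \sum_(l <- s) nc (x l) * nc (y l) <= K.

Lemma normc_pairing_terms x y l :
  nc (pairing_terms x y l) = nc (x l) * nc (y l).
Proof. by rewrite Normc.normcM normc_conj. Qed.

Lemma dominated_terms x y K : dominated x y K ->
  forall s, uniq s -> \sum_(l <- s) nc (pairing_terms x y l) <= K.
Proof.
move=> xyK s us; under eq_bigr do rewrite normc_pairing_terms.
exact: xyK.
Qed.

Lemma pairing_cvg x y K : dominated x y K ->
  summability.partial_sum (pairing_terms x y) @ summability.totally
    --> pairing x y.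
Proof. by move=> /dominated_terms; exact: cvg_partial_sum. Qed.

Lemma pairing_le x y K : dominated x y K -> nc (pairing x y) <= K.
Proof. by move=> /dominated_terms; exact: lim_partial_sum_le. Qed.

Lemma pairing_unique x y (L : R[i]^o) :
  summability.partial_sum (pairing_terms x y) @ summability.totally --> L ->
  pairing x y = L.
Proof. by move=> ?; apply: cvg_lim => //; exact: norm_hausdorff. Qed.

Lemma pairing_finite J x y : truncate J x = x ->
  pairing x y = head_pairing J x y.
Proof.
move=> xJ; apply: pairing_unique; apply/cvg_normcP => r r0.
exists (finmap.seq_fset tt (levels J)) => // A JA /=.
rewrite partial_sumE (big_uniq_support (s := levels J)).
- by rewrite subrr Normc.normc0.
- exact: levels_uniq.
- exact: finmap.fset_uniq.
- move=> l lJ; move/finmap.fsubsetP : JA; apply.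
  by rewrite finmap.seq_fsetE.
- move=> l; rewrite mem_levels => /negbTE lJ.
  by rewrite /pairing_terms -xJ /truncate lJ mul0r.
Qed.

Lemma pairing_linear (c : R[i]) x x' y K K' :
  dominated x y K -> dominated x' y K' ->
  pairing (c *: x + x') y = c * pairing x y + pairing x' y.
Proof.
move=> /pairing_cvg h /pairing_cvg h'; apply: pairing_unique.
apply: (cvg_trans _ (cvgD (@cvgZr _ R[i]^o _ _ _ c _ _ h) h')).
apply: near_eq_cvg; near=> A.
rewrite -[LHS]/(c * summability.partial_sum (pairing_terms x y) A +
  summability.partial_sum (pairing_terms x' y) A) !partial_sumE.
rewrite mulr_sumr -big_split/=.
apply: eq_bigr => l _.
rewrite /pairing_terms [(c *: x + x') l]/(c * x l + x' l) mulrDl -mulrA.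
by [].
Unshelve. all: by end_near. Qed.

Lemma pairing_antilinear (c : R[i]) x y y' K K' :
  dominated x y K -> dominated x y' K' ->
  pairing x (c *: y + y') = c^* * pairing x y + pairing x y'.
Proof.
move=> /pairing_cvg h /pairing_cvg h'; apply: pairing_unique.
apply: (cvg_trans _ (cvgD (@cvgZr _ R[i]^o _ _ _ c^* _ _ h) h')).
apply: near_eq_cvg; near=> A.
rewrite -[LHS]/(c^* * summability.partial_sum (pairing_terms x y) A +
  summability.partial_sum (pairing_terms x y') A) !partial_sumE.
rewrite mulr_sumr -big_split/=.
apply: eq_bigr => l _.
rewrite /pairing_terms [(c *: y + y') l]/(c * y l + y' l) rmorphD rmorphM/=.
by rewrite mulrDr mulrCA.
Unshelve. all: by end_near. Qed.

Lemma dominatedZl (t : R) x x' y K : 0 <= t ->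
  (forall l, nc (x' l) <= t * nc (x l)) -> dominated x y K ->
  dominated x' y (t * K).
Proof.
move=> t0 xx' h s us; apply: le_trans (ler_wpM2l t0 (h s us)).
rewrite mulr_sumr; apply: ler_sum => l _; rewrite mulrA.
by rewrite ler_wpM2r ?normc_ge0.
Qed.

Lemma normc_scale (t : R) x l : 0 < t -> nc ((t%:C%C *: x) l) = t * nc (x l).
Proof. by move=> t0; rewrite Normc.normcM normc_real gtr0_norm. Qed.

Lemma dominated_unscale (t : R) x y K : 0 < t ->
  dominated (t%:C%C *: x) y K -> dominated x y (t^-1 * K).
Proof.
move=> t0; apply: dominatedZl => [|l]; first by rewrite invr_ge0 ltW.
by rewrite normc_scale// mulrA mulVf ?mul1r// gt_eqF.
Qed.

Lemma dominatedC x y K : dominated x y K -> dominated y x K.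
Proof. by move=> h s us; under eq_bigr do rewrite mulrC; exact: h. Qed.

Definition delta (l : Lambda) : Omega R := fun l' => (l' == l)%:R.

Lemma truncate_delta l : truncate (tag l).+1 (delta l) = delta l.
Proof.
apply/funext => l'; rewrite /truncate/delta; case: ltnP => //.
by have [->|//] := eqVneq l' l; rewrite ltnn.
Qed.

Lemma scale_deltaE (c : R[i]) l l' :
  (c *: (delta l : Omega R)) l' = if l' == l then c else 0.
Proof.
have -> : (c *: (delta l : Omega R)) l' = c * (l' == l)%:R :> R[i] by [].
by case: (l' == l); rewrite ?mulr1 ?mulr0.
Qed.

Lemma pairing_scale_delta (c : R[i]) l y :
  pairing (c *: delta l) y = c * (y l)^*.
Proof.
have cJ : truncate (tag l).+1 (c *: delta l) = c *: delta l.
  apply/funext => l'; rewrite /truncate scale_deltaE; case: ltnP => //.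
  by have [->|//] := eqVneq l' l; rewrite ltnn.
rewrite (pairing_finite _ cJ) /head_pairing.
rewrite (big_uniq_support (s := [:: l])) ?levels_uniq//.
- by rewrite big_seq1 /pairing_terms scale_deltaE eqxx.
- by move=> l'; rewrite inE => /eqP ->; rewrite mem_levels.
- move=> l'; rewrite inE /pairing_terms scale_deltaE => /negbTE ->.
  by rewrite mul0r.
Qed.

Lemma pairing_delta l y : pairing (delta l) y = (y l)^*.
Proof. by rewrite -[delta l]scale1r pairing_scale_delta mul1r. Qed.

End pairing.

(** * Polars *)

(** The polar is taken among all sequences: against finitely supported [x] the pairing is a finite
    sum, meaningful before [y] is known to define a continuous form. *)
Definition polar (R : realType) (D : set (Omega R)) : set (Omega R) :=
  [set y | forall x, D x -> nc (pairing x y) <= 1].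

Lemma lam_inj j : injective (@lam j).
Proof.
by move=> k k' /eqP; rewrite /lam -tag_eqE /tag_eq/= eqxx/= tagged_asE => /eqP.
Qed.

(** The test sequence has modulus at most [s], lives on [P] and carries the phases of [y], so each
    term of the pairing equals [s * nc (y (lam k))]. *)
Lemma polar_test (R : realType) (nu : R -> \bar R) alpha e n (y : Omega R)
    j (P : seq 'I_(2 ^ j)) (s : R) :
  polar (@finitely_supported R `&` Snu_ball nu alpha e n) y ->
  uniq P -> 0 <= s ->
  (forall x, (forall l, nc (x l) <= s) ->
             (forall l, l \notin map (@lam j) P -> x l = 0) ->
             Snu_ball nu alpha e n x) ->
  \sum_(k <- P) s * nc (y (lam k)) <= 1.
Proof.
move=> yn uP s0 test.
(* Where [y l = 0] the quotient is 0, since the inverse of 0 is 0; the term it should produce is 0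
   as well. *)
pose x : Omega R := fun l =>
  if l \in map (@lam j) P then s%:C%C * (y l / `|y l|) else 0.
have xP l : l \notin map (@lam j) P -> x l = 0 by rewrite /x => /negbTE ->.
have xB : Snu_ball nu alpha e n x.
  apply: test => // l; rewrite /x; case: ifP => _; last by rewrite Normc.normc0.
  rewrite Normc.normcM normc_real ger0_norm// ler_piMr//.
  rewrite Normc.normcM Normc.normcV.
  rewrite norm_normc normc_real ger0_norm ?normc_ge0//.
  by have [->|y0] := eqVneq (nc (y l)) 0; rewrite ?mul0r// mulfV.
have xJ : truncate j.+1 x = x.
  apply/funext => l; rewrite /truncate; case: ltnP => // jl.
  by rewrite xP//; apply/negP => /mapP[k _ lk]; rewrite lk ltnn in jl.
have /= := yn x (conj (ex_intro _ _ xJ) xB); rewrite (pairing_finite _ xJ).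
suff -> : head_pairing j.+1 x y = (\sum_(k <- P) s * nc (y (lam k)))%:C%C.
  rewrite normc_real ger0_norm// sumr_ge0// => k _.
  by rewrite mulr_ge0 ?normc_ge0.
rewrite /head_pairing (big_uniq_support (s := map (@lam j) P)).
- rewrite big_map rmorph_sum/= !big_seq; apply: eq_bigr => k kP.
  rewrite /pairing_terms /x map_f// rmorphM/= -norm_normc -mulrA; congr (_ * _).
  have [y0|y0] := eqVneq `|y (lam k)| 0; first by rewrite y0 invr0 mulr0 mul0r.
  by rewrite mulrAC -normCK expr2 mulfK.
- by rewrite map_inj_uniq//; exact: lam_inj.
- exact: levels_uniq.
- by move=> _ /mapP[k _ ->]; rewrite mem_levels.
- by move=> l lP; rewrite /pairing_terms xP// mul0r.
Qed.

Lemma card_ge_max (R : realType) (x : Omega R) j t : (card_ge x j t <= 2 ^ j)%N.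
Proof. by rewrite /card_ge (leq_trans (max_card _))// card_ord. Qed.

Lemma admissible_val (R : realType) (nu : R -> \bar R) (a : R) :
  admissible nu -> nu a = -oo%E \/ exists2 v, nu a = v%:E & 0 <= v.
Proof.
move=> [_ _ nu01 _]; have [->|/andP[]] := nu01 a; first by left.
case: (nu a) => [v| |]; last by left.
  by rewrite lee_fin => v0 _; right; exists v.
by rewrite leye_eq.
Qed.

Lemma admissible_ge0 (R : realType) (nu : R -> \bar R) :
  admissible nu -> exists a, (0 <= nu a)%E.
Proof.
move=> nuA; have [_ _ _ [a aN]] := nuA; exists a.
by have [//|[v -> v0]] := admissible_val a nuA; rewrite lee_fin.
Qed.

(** The same [h] shifts the argument and is added to the value, so that in [polar_count] one number
    serves as shift and as gain in the exponent. *)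
Lemma admissible_rc (R : realType) (nu : R -> \bar R) (a : R) (d : {posnum R}) :
  admissible nu -> \forall h \near 0^'+,
    (nu (a + h)%R + h%:E <= nu a + d%:num%:E)%E.
Proof.
move=> nuA; have [_ rc _ _] := nuA.
have near_lt c : (nu a < c%:E)%E ->
    \forall h \near 0^'+, (nu (a + h)%R < c%:E)%E.
  move=> nuac; apply/(nbhs_right0P a (fun b => (nu b < c%:E)%E)).
  apply: (rc a [set y | (y < c%:E)%E]).
  by apply: open_nbhs_nbhs; split => //; exact: open_ereal_lt_ereal.
have [aN|[v E _]] := admissible_val a nuA.
  (* An admissible profile has no finite negative value, so a value below -1 is -oo. *)
  have aN1 : (nu a < (-1)%:E)%E by rewrite aN ltNyr.
  near=> h; have : (nu (a + h)%R < (-1)%:E)%E by near: h; exact: near_lt.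
  have [-> _|[v -> v0]] := admissible_val (a + h) nuA.
    by rewrite addNye leNye.
  by rewrite lte_fin => /(le_lt_trans v0); rewrite ltr0N1.
rewrite E.
near=> h.
apply: (@le_trans _ _ ((v + d%:num / 2)%:E + (d%:num / 2)%:E)%E); last first.
  by rewrite -!EFinD -addrA -splitr.
apply: leeD; first apply: ltW.
  by near: h; apply: near_lt; rewrite E lte_fin ltrDl.
by rewrite lee_fin; near: h; apply: nbhs_right_le.
Unshelve. all: by end_near. Qed.

Lemma pow2_ge (R : realType) (b : \bar R) (c : R) j :
  (c%:E <= b)%E -> ((2 `^ (c * j%:R))%:E <= pow2 b j)%E.
Proof.
case: b => [r| |]//= bc; rewrite ?leey// lee_fin.
by rewrite ler_powR ?ler1n// ler_wpM2r// -lee_fin.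
Qed.

(** If [y] were at least [2 ^ (- a' j)] on too many indices of level [j], a sequence of height about
    [2 ^ (- a j)] placed on some of them would lie in the ball and pair with [y] to more than 1.
    Right continuity gives one [d] for the finitely many pairs of parameters of the ball. *)
Lemma polar_count (R : realType) (nu : R -> \bar R) alpha e n : admissible nu ->
  exists2 d, 0 < d & forall a' b, (dual_profile nu (a' - d) < b%:E)%E ->
    \forall j \near \oo, forall y,
      polar (@finitely_supported R `&` Snu_ball nu alpha e n) y ->
      (card_ge y j (2 `^ (- (a' * j%:R))))%:R <= 2 `^ (b * j%:R).
Proof.
move=> nuA; have [nu_homo _ _ _] := nuA.
have rc (ik : 'I_n.+1 * 'I_n.+1) := admissible_rc (alpha ik.1) (e ik.2) nuA.
have [d [d0 nu_d]] := filter_ex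
  (filterI (nbhs_right_gt (0 : R)) (filter_forall _ rc)).
exists d => // a' b nub.
(* The bound before clipping: [c] witnesses that the infimum in the dual profile at [a' - d] is
   below [b1 - (a' - d)]. *)
have core b1 : (exists2 c, (nu c - c%:E > (a' - d)%:E)%E & c + (a' - d) < b1) ->
    \forall j \near \oo, forall y,
      polar (@finitely_supported R `&` Snu_ball nu alpha e n) y ->
      (card_ge y j (2 `^ (- (a' * j%:R))))%:R <= 2 `^ (b1 * j%:R).
  move=> [c nuc cb1].
  have [cN|[v E v0]] := admissible_val c nuA.
    by rewrite cN addNye ltNge leNye in nuc.
  move: nuc; rewrite E -EFinB lte_fin => vc.
  (* If [alpha i > a], then [nu c <= nu (alpha i + d) <= nu (alpha i) + e k - d]
     by right continuity, so the ball contains the sequences of size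
     [r / 2 * 2 `^ (- (a * j))] on at most [r * 2 `^ ((v + d) * j)] positions. *)
  pose a := c - d; pose r : R := n.+1%:R^-1 / 2.
  have r0 : 0 < r by rewrite divr_gt0// invr_gt0 ltr0n.
  near=> j => y yn.
  (* Chosen so that [T * s * 2 ^ (- a' j) = 1] for the height [s] below; [p > T] indices then push
     the pairing beyond 1. *)
  pose T := 2 / r * 2 `^ ((a + a') * j%:R).
  have T0 : 0 <= T by rewrite mulr_ge0 ?powR_ge0// divr_ge0// ltW.
  have Tb : T <= 2 `^ (b1 * j%:R).
    by rewrite /T; near: j; apply: le_powR_near; rewrite /a; lra.
  (* The integer [p] just above [T] has to fit into the count allowed by the ball: half of [r] pays
     for [T], half for the rounding. *)
  have Tv : T + 1 <= r * 2 `^ ((v + d) * j%:R).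
    rewrite [X in _ <= X * _](splitr r) mulrDl lerD//.
      rewrite -ler_pdivrMl ?divr_gt0// /T mulrA; near: j; apply: le_powR_near.
      by rewrite /a; lra.
    rewrite -ler_pdivrMl ?divr_gt0//.
    apply: (@le_trans _ _ ((r / 2)^-1 * 2 `^ (0 * j%:R))).
      by rewrite mul0r powRr0.
    by near: j; apply: le_powR_near; rewrite ltr_wpDl.
  apply: le_trans Tb; rewrite leNgt; apply/negP => TN.
  pose p := (Num.trunc T).+1.
  have Tp : T < p%:R by exact: truncnS_gt.
  have pT : p%:R <= T + 1.
    by rewrite /p -natr1 lerD2r; have /andP[] := truncn_itv T0.
  set Q := [pred k : 'I_(2 ^ j) | 2 `^ (- (a' * j%:R)) <= nc (y (lam k))].
  have pQ : (p <= #|Q|)%N by rewrite /p truncn_lt_nat.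
  pose P := take p (enum Q).
  have sP : size P = p by rewrite size_takel// -cardE.
  have uP : uniq P by rewrite take_uniq// enum_uniq.
  pose s := r / 2 * 2 `^ (- (a * j%:R)).
  have s0 : 0 <= s by rewrite mulr_ge0 ?powR_ge0// divr_ge0// ltW.
  have /(polar_test yn uP s0) : forall x : Omega R, (forall l, nc (x l) <= s) ->
      (forall l, l \notin map (@lam j) P -> x l = 0) ->
      Snu_ball nu alpha e n x.
    move=> x xs xP i k; rewrite -ltnS => im; rewrite -ltnS => km.
    apply: (@le_lt_trans _ _ r%:E); last first.
      by rewrite lte_fin /r ltr_pdivrMr// ltr_pMr ?ltr1n//.
    apply: dist_le => [|j']; first exact: ltW.
    have [jj'|jj'] := eqVneq j' j; last first.
      rewrite card_ge_eq0 => [|k']; first by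
        rewrite mule_ge0 ?pow2_ge0// lee_fin ltW.
      rewrite xP ?Normc.normc0 ?mulr_gt0 ?powR_gt0//.
      by apply/negP => /mapP[? _ /(congr1 tag)/=]; exact/eqP.
    rewrite {j'}jj'.
    have [ai|ia] := leP (alpha i) a.
      rewrite card_ge_eq0 => [|k']; first by
        rewrite mule_ge0 ?pow2_ge0// lee_fin ltW.
      apply: le_lt_trans (xs _) _.
      apply: (@lt_le_trans _ _ (r * 2 `^ (- (a * j%:R)))).
        by rewrite ltr_pM2r ?powR_gt0// ltr_pdivrMr// ltr_pMr// ltr1n.
      by rewrite ler_pM2l// ler_powR ?ler1n// lerN2 ler_wpM2r.
    apply: (@le_trans _ _ (r * 2 `^ ((v + d) * j%:R))%:E).
      rewrite lee_fin; apply: le_trans (le_trans pT Tv); rewrite ler_nat.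
      rewrite -sP -(card_uniqP uP); apply: subset_leq_card.
      apply/fintype.subsetP => k'; rewrite inE; apply: contraTT => k'P.
      rewrite -ltNge xP ?Normc.normc0 ?mulr_gt0 ?powR_gt0//.
      by rewrite mem_map//; exact: lam_inj.
    rewrite EFinM; apply: lee_wpmul2l; first by rewrite lee_fin ltW.
    apply: pow2_ge.
    apply: le_trans (nu_d (Ordinal im, Ordinal km)).
    rewrite EFinD leeD2r// -E; apply: nu_homo.
    by rewrite -[c](subrK d) lerD2r ltW.
  apply/negP; rewrite -ltNge.
  apply: (@lt_le_trans _ _ (p%:R * (s * 2 `^ (- (a' * j%:R))))).
    have E1 : 1 = T * (s * 2 `^ (- (a' * j%:R))).
      have uvw : 2 `^ ((a + a') * j%:R) * 2 `^ (- (a * j%:R)) *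
          2 `^ (- (a' * j%:R)) = 1 :> R.
        rewrite -!powRD ?pnatr_eq0 ?implybT// -[RHS](powRr0 2).
        by congr (_ `^ _); ring.
      rewrite -[LHS]uvw /T /s; field.
      by rewrite /r mulf_neq0// invr_neq0// pnatr_eq0.
    rewrite [ltLHS]E1 ltr_pM2r// mulr_gt0 ?powR_gt0//.
    by rewrite mulr_gt0 ?powR_gt0 ?divr_gt0.
  rewrite -sP -[X in X%:R * _]count_predT -sum1_count natr_sum mulr_suml.
  rewrite big_seq [leRHS]big_seq; apply: ler_sum => k kP.
  rewrite mul1r ler_wpM2l//.
  by have := mem_take kP; rewrite mem_enum inE.
have [b1|b1] := leP 1 b.
  near=> j => y _; apply: (@le_trans _ _ (2 `^ (1 * j%:R))).
    by rewrite mul1r powR_mulrn// -natrX ler_nat card_ge_max.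
  by rewrite ler_powR ?ler1n// ler_wpM2r.
move: nub; rewrite /dual_profile; set c := (_ + _)%E => cb.
(* If [c < 0], clipping yields -oo and [b] need not exceed [c]; a negative [b'] above [c] then makes
   the counts vanish from some level on. *)
have [b' cb' b'b] : exists2 b', (c < b'%:E)%E & b' = b \/ b' < 0.
  move: cb; rewrite /clip; case: ifPn => c0 cb.
    by have [b' ? ?] := lt_fin_dense c0; exists b' => //; right.
  exists b; last by left.
  by move: cb; rewrite gt_min => /orP[//|]; rewrite lte_fin ltNge ltW.
have [u nuu ub] : exists2 u, (nu u - u%:E > (a' - d)%:E)%E & u + (a' - d) < b'.
  move: cb'; rewrite /c -lteBrDl// => /ereal_inf_lt[_ [u nuu <-]].
  by rewrite -EFinB lte_fin ltrBrDr => ub; exists u.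
have {}core := core b' (ex_intro2 _ _ u nuu ub).
case: b'b => [<-//|b'0]; near=> j => y yn.
have -> : card_ge y j (2 `^ (- (a' * j%:R))) = 0%N.
  apply: (@count_lt1 R _ j b') => //; first by near: j; exists 1%N.
  by move: yn; move: (y); near: j.
exact: powR_ge0.
Unshelve. all: by end_near. Qed.

Lemma polar_count_bounded (R : realType) (nu : R -> \bar R) alpha e n :
  admissible nu -> exists2 d, 0 < d & forall d', 0 < d' <= d ->
    count_bounded (shift_profile (dual_profile nu) d')
      (polar (@finitely_supported R `&` Snu_ball nu alpha e n)).
Proof.
(* For [d' <= d / 2] the margin [d - d'] is positive; it moves the threshold exponent strictly
   beyond [a]. *)
move=> /(@polar_count _ _ alpha e n)[d d0 hd]; exists (d / 2).
  by rewrite divr_gt0.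
move=> d' /andP[d'0 d'd] a b ab; exists (a + (d - d')); first by lra.
by apply: hd; rewrite (_ : a + _ - d = a - d')//; ring.
Qed.

Lemma count_bounded_Snu (R : realType) (nu : R -> \bar R) A :
  count_bounded nu A -> A `<=` Snu_set nu.
Proof.
move=> Ab y Ay; apply/Snu_setP => a b /Ab[c ac cA].
exists (c - a); first by rewrite subr_gt0.
by rewrite addrC subrK; apply: filterS cA => j; exact.
Qed.

(** * The dual space *)

Section dual_space.
Context {R : realType} (nu : R -> \bar R) (alpha : nat -> R).
Variable e : nat -> {posnum R}.
Hypothesis alpha_dense : dense (range alpha).
Hypothesis e_cvg0 : (e m)%:num @[m --> \oo] --> (0 : R).
Hypothesis nu_admissible : admissible nu.
Hypothesis nu_lt0 : exists a, (nu a < 0)%E.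

Local Notation V := (Snu nu alpha e).
Local Notation B := (Snu_ball nu alpha e).
Local Notation mu := (shift_profile (dual_profile nu)).

Lemma pairing_bounded eps : 0 < eps -> exists n K, forall x y,
  B n x -> Snu_ball (mu eps) alpha e n y -> dominated x y K.
Proof.
move=> eps0; have [nu_homo _ _ _] := nu_admissible.
by apply: pairing_bound => //; exact: admissible_ge0.
Qed.

Lemma dual_seq_bounded eps y : 0 < eps -> Snu_set (mu eps) y ->
  exists n K, forall x, B n x -> dominated x y K.
Proof.
move=> /pairing_bounded[n [K nK]] yS.
have [t t0 ty] := @Snu_ball_absorb _ _ alpha e _ n yS.
exists n, (t^-1 * K) => x xn.
have yB : Snu_ball (mu eps) alpha e n (t%:C%C *: y).
  by apply: ty => l; rewrite normc_scale.
apply/dominatedC; apply: dominated_unscale t0 (dominatedC (nK _ _ xn yB)).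
Qed.

Lemma dominated_Snu eps x y : 0 < eps -> Snu_set nu x -> Snu_set (mu eps) y ->
  exists K, dominated x y K.
Proof.
move=> eps0 xS /(dual_seq_bounded eps0)[n [K nK]].
have [t t0 tx] := @Snu_ball_absorb _ _ alpha e _ n xS.
have /nK xB : B n (t%:C%C *: x).
  by apply: tx => l; rewrite normc_scale.
exists (t^-1 * K); apply: dominated_unscale t0 xB.
Qed.

Lemma dominated_dual (x : V) (y : dual_seqs nu) :
  exists K, dominated (val x) (val y) K.
Proof.
have [eps eps0 yS] := set_mem (valP y).
exact: dominated_Snu eps0 (SnuP x) yS.
Qed.

Lemma dual_form_linear (y : dual_seqs nu) :
  linear (@dual_form R nu alpha e y : V -> R[i]^o).
Proof.
move=> c x x'; have [K xK] := dominated_dual x y.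
have [K' x'K'] := dominated_dual x' y.
exact: pairing_linear xK x'K'.
Qed.

Lemma linear_small (f : {linear V -> R[i]^o}) n K :
  (forall x, B n (val x) -> nc (f x) <= K) ->
  forall r, 0 < r -> exists m, forall x, B m (val x) -> nc (f x) < r.
Proof.
(* Chosen so that [K / s < r]; the added 1 keeps [s] positive. *)
move=> fK r r0; pose s := (`|K| + 1) / r.
have s0 : 0 < s by rewrite divr_gt0// ltr_wpDl.
have [m hm] := @Snu_ball_scale _ nu alpha e s n.
exists m => x xm.
have /fK : B n (val (s%:C%C *: x)).
  by apply: hm xm => l; rewrite normc_scale.
rewrite linearZ Normc.normcM normc_real gtr0_norm// => fxK.
rewrite -(ltr_pM2l s0); apply: le_lt_trans fxK _.
rewrite /s divfK ?gt_eqF//; apply: le_lt_trans (ler_norm _) _.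
by rewrite ltrDl.
Qed.

Lemma linear_bounded_continuous (f : {linear V -> R[i]^o}) n K :
  (forall x, B n (val x) -> nc (f x) <= K) -> continuous f.
Proof.
move=> fK z; apply/(cvg_normcP (nbhs_filter z)) => r r0.
have [m hm] := linear_small fK r0.
apply/nbhs_SnuP; exists m => z' zz' /=.
by rewrite normcB -linearB; exact: hm.
Qed.

Lemma linear_continuous_bounded (f : {linear V -> R[i]^o}) :
  continuous f -> exists n, forall x, B n (val x) -> nc (f x) <= 1.
Proof.
move=> /(_ 0)/(cvg_normcP (nbhs_filter (0 : V)))/(_ 1 ltr01)/nbhs_SnuP[n hn].
exists n => x xn; have /= := hn x.
by rewrite -linearB sub0r linearN normcN subr0 => /(_ xn)/ltW.
Qed.

Lemma dual_form_continuous (y : dual_seqs nu) :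
  continuous (@dual_form R nu alpha e y : V -> R[i]^o).
Proof.
have [eps eps0 yS] := set_mem (valP y).
have [n [K nK]] := dual_seq_bounded eps0 yS.
pose f : {linear V -> R[i]^o} := HB.pack
  (@dual_form R nu alpha e y : V -> R[i]^o)
  (GRing.isLinear.Build _ _ _ _ _ (dual_form_linear y)).
apply: (@linear_bounded_continuous f n K) => x xn.
exact/pairing_le/nK.
Qed.

Lemma dual_form_inj : injective (@dual_form R nu alpha e).
Proof.
move=> y y' yy'; apply/val_inj/funext => l.
have dS : delta l \in Snu_pred nu.
  by apply/mem_set/finite_Snu; exists (tag l).+1; exact: truncate_delta.
have := congr1 (fun f => f (exist _ (delta l) dS : V)) yy'.
by rewrite /dual_form/= !pairing_delta => /(inv_inj conjCK).
Qed.

(** The values of [f] at the unit sequences give [y]. Since [f] is bounded by 1 on a ball, [y] lies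
    in a polar and hence in the dual set. Both forms agree on finitely supported sequences, and
    truncations of [x] approach [x]. *)
Lemma dual_form_surj (f : {linear V -> R[i]^o}) : continuous f ->
  exists y : dual_seqs nu, dual_form y = f :> (V -> R[i]^o).
Proof.
move=> f_cont; have [n fn] := linear_continuous_bounded f_cont.
have finS x : finitely_supported x -> x \in Snu_pred nu.
  by move=> xf; apply/mem_set/finite_Snu.
have dfin l : finitely_supported (delta l : Omega R).
  by exists (tag l).+1; exact: truncate_delta.
pose d l : V := exist _ (delta l) (finS _ (dfin l)).
(* Conjugated because the pairing conjugates its second argument. *)
pose y : Omega R := fun l => (f (d l))^*.
have fE J (x : V) : truncate J (val x) = val x ->
    f x = head_pairing J (val x) y.
  move=> xJ; have xE : x = \sum_(l <- levels J) val x l *: d l.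
    apply: val_inj; rewrite raddf_sum/=; apply/funext => l.
    rewrite fct_sumE; have [lJ|Jl] := ltnP (tag l) J.
      rewrite (bigD1_seq l) ?levels_uniq ?mem_levels//= big1 => [|l' ll'].
        by rewrite addr0 scale_deltaE eqxx.
      by rewrite scale_deltaE eq_sym (negbTE ll').
    rewrite big_seq big1 => [|l'].
      by rewrite -[in LHS]xJ /truncate ltnNge Jl.
    rewrite mem_levels scale_deltaE => l'J; rewrite ifN//.
    by apply: contraTneq l'J => <-; rewrite -leqNgt.
  rewrite [in LHS]xE linear_sum; apply: eq_bigr => l _.
  by rewrite linearZ /pairing_terms /y conjCK.
have yn : polar (@finitely_supported R `&` B n) y.
  move=> x [[J xJ] xn]; rewrite (pairing_finite _ xJ).
  by rewrite -(fE J (exist _ x (finS x (ex_intro _ J xJ)))) //; exact: fn.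
have [eps eps0 /(_ eps)] := @polar_count_bounded _ _ alpha e n nu_admissible.
rewrite eps0 lexx => /(_ isT)/count_bounded_Snu/(_ y yn) yS.
have yD : y \in dual_pred nu by apply/mem_set; exists eps.
pose y' : dual_seqs nu := exist _ y yD.
pose g : {linear V -> R[i]^o} := HB.pack
  (@dual_form R nu alpha e y' : V -> R[i]^o)
  (GRing.isLinear.Build _ _ _ _ _ (dual_form_linear y')).
exists y'; apply/funext => x.
apply/eqP; rewrite -subr_eq0; apply/eqP/Normc.eq0_normc/eqP.
rewrite eq_le normc_ge0 andbT; apply/ler_addgt0Pr => r r0.
have r20 : 0 < r / 2 by rewrite divr_gt0.
have [m hm] := linear_small fn r20.
have [m' [K gK]] := dual_seq_bounded eps0 yS.
have [m'' hm''] := @linear_small g m' K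
  (fun x xm => pairing_le (gK _ xm)) _ r20.
have [J xJ] := @Snu_ball_truncate _ _ alpha e _ (maxn m m'') (SnuP x).
pose xJ' : V := exist _ (truncate J (val x)) (finS _ (truncateP J (val x))).
have fg : f xJ' = g xJ'.
  have trJ : truncate J (val xJ') = val xJ'.
    by apply/funext => l /=; rewrite /truncate; case: (tag l < J)%N.
  by rewrite (fE _ _ trJ); exact/esym/(pairing_finite y trJ).
rewrite add0r [X in nc X](_ : _ = g (x - xJ') - f (x - xJ')); last first.
  have -> : g (x - xJ') = g x - g xJ' by exact: linearB.
  have -> : f (x - xJ') = f x - f xJ' by exact: linearB.
  by rewrite fg opprB addrA subrK.
rewrite (splitr r); apply: le_trans (le_normcD _ _) _; rewrite normcN.
apply: lerD; apply/ltW; [apply: hm''|apply: hm]; apply: le_Snu_ball xJ.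
  exact: leq_maxr.
exact: leq_maxl.
Qed.

End dual_space.

(** * The strong topology *)

Section strong_topology.
Context {R : realType} (nu : R -> \bar R) (alpha : nat -> R).
Variable e : nat -> {posnum R}.
Hypothesis alpha_dense : dense (range alpha).
Hypothesis e_cvg0 : (e m)%:num @[m --> \oo] --> (0 : R).
Hypothesis nu_admissible : admissible nu.
Hypothesis nu_lt0 : exists a, (nu a < 0)%E.

Local Notation V := (Snu nu alpha e).
Local Notation Y := (dual_seqs nu).
Local Notation T := (Topological.Pack (strong_topology nu alpha e)).
Local Notation B := (Snu_ball nu alpha e).
Local Notation mu := (shift_profile (dual_profile nu)).

(** The balls are stable under domination of moduli, so absorption by complex scalars reduces to one
    positive real factor. *)
Lemma vn_boundedP (A : set V) : vn_bounded A <->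
  forall n, exists2 t : R, 0 < t & forall x, A x -> forall z,
    (forall l, nc (z l) <= t * nc (val x l)) -> B n z.
Proof.
split=> [bA n|bA U /nbhs_SnuP[n nU]].
  have /bA[r r0 Ar] : nbhs (0 : V) [set v | B n (val v)].
    by apply/nbhs_SnuP; exists n => v /=; rewrite subr0.
  have nr0 : 0 < nc r.
    rewrite lt_neqAle normc_ge0 andbT eq_sym.
    by apply/eqP => /Normc.eq0_normc rE; rewrite rE ltxx in r0.
  exists (nc r)^-1; first by rewrite invr_gt0.
  have rr : r <= `|r| by rewrite ger0_norm// ltW.
  move=> x /(Ar r rr)[v vB <-] z zx.
  apply: Snu_ball_dominated vB => l; apply: le_trans (zx l) _.
  by rewrite /= Normc.normcM mulrA mulVf ?mul1r// gt_eqF.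
have [t t0 tA] := bA n.
exists (t^-1)%:C%C; first by rewrite ltcE/= eqxx invr_gt0.
move=> s; rewrite norm_normc lecR => ts x /tA xB.
have s0 : 0 < nc s by apply: lt_le_trans ts; rewrite invr_gt0.
have s_neq0 : s != 0 by apply: contraTneq s0 => ->; rewrite Normc.normc0 ltxx.
exists (s^-1 *: x); last by rewrite scalerA mulfV ?scale1r.
apply: nU => /=; rewrite subr0; apply: xB => l.
rewrite Normc.normcM Normc.normcV ler_wpM2r ?normc_ge0//.
by rewrite -[t]invrK lef_pV2 ?posrE ?invr_gt0.
Qed.

Lemma vn_boundedU (A A' : set V) :
  vn_bounded A -> vn_bounded A' -> vn_bounded (A `|` A').
Proof.
move=> /vn_boundedP bA /vn_boundedP bA'; apply/vn_boundedP => n.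
have [t t0 tA] := bA n; have [t' t'0 tA'] := bA' n.
exists (Num.min t t'); first by rewrite lt_min t0.
move=> x [Ax|A'x] z zx; [apply: (tA x) => // l|apply: (tA' x) => // l];
  apply: le_trans (zx l) _; rewrite ler_wpM2r ?normc_ge0// ge_min lexx//.
by rewrite orbT.
Qed.

Lemma nbhs_strongP (y : T) (U : set T) : nbhs y U <->
  exists2 A : set V, vn_bounded A & exists2 r : R, 0 < r &
    forall z : Y, (forall x, A x ->
      nc (pairing (val x) (val y) - pairing (val x) (val z)) < r) -> U z.
Proof.
split.
- pose D := [set Ar : set V * R | vn_bounded Ar.1 /\ 0 < Ar.2].
  pose W (Ar : set V * R) := [set z : Y | forall x, Ar.1 x ->
    nc (pairing (val x) (val y) - pairing (val x) (val z)) < Ar.2].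
  pose F := filter_from D W.
  have FF : Filter F.
    apply: filter_from_filter.
      exists (set0, 1); split=> //=; apply/vn_boundedP => n.
      by exists 1.
    move=> [A r] [A' r'] [/= bA r0] [/= bA' r'0].
    exists (A `|` A', Num.min r r').
      by split=> /=; [exact: vn_boundedU|rewrite lt_min r0].
    move=> z /= Wz; split=> x /= Ax; have /Wz : (A `|` A') x by [left|right].
      by rewrite lt_min => /andP[].
    by rewrite lt_min => /andP[].
  move=> [_ [[G oG <-] Gy GU]].
  suff : F (@dual_form R nu alpha e @^-1` G).
    move=> [[A r] [bA r0] AG]; exists A => //; exists r => // z Az.
    by apply: GU; exact: AG.
  have : {family @vn_bounded _ V, @dual_form R nu alpha e @ F -->
      @dual_form R nu alpha e y}.
    apply/fam_cvgP => A bA P /uniform_nbhs[E [entE EP]].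
    move: entE; rewrite -entourage_ballE => -[d /= d0 dE].
    (* Radii are positive elements of [R[i]], hence real. *)
    have dr0 : 0 < complex.Re d by move: d0; rewrite ltcE => /andP[].
    exists (A, complex.Re d) => // z Az; apply: EP => x Ax; apply: dE => /=.
    rewrite -ball_normE /ball_/=; have := Az x Ax => /=.
    rewrite norm_normc; move: d0; rewrite !ltcE /= => /andP[/eqP -> _] ->.
    by rewrite eqxx.
  by apply; apply: open_nbhs_nbhs.
- move=> [A bA [r r0 AU]].
  have rc0 : 0 < r%:C%C by rewrite ltcE/= eqxx.
  have : nbhs (@dual_form R nu alpha e y)
      [set g | forall x, A x ->
        ball (@dual_form R nu alpha e y x) r%:C%C (g x)].
    have /fam_cvgP : {family @vn_bounded _ V, nbhs (@dual_form R nu alpha e y)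
      --> @dual_form R nu alpha e y} by [].
    move=> /(_ A bA); apply; apply/uniform_nbhs.
    exists [set ab | ball ab.1 r%:C%C ab.2]; split => //.
    by rewrite -entourage_ballE; exists r%:C%C.
  move=> /(@initial_continuous _ _ (@dual_form R nu alpha e) y) h.
  apply: (@filterS T (nbhs y) _ _ _ _ h) => z zA; apply: AU => x Ax.
  have := zA x Ax.
  by rewrite -ball_normE /ball_/= norm_normc ltcR.
Qed.

Lemma bounded_dominated (A : set V) eps : vn_bounded A -> 0 < eps ->
  exists n K, forall x, A x -> forall y, Snu_ball (mu eps) alpha e n y ->
    dominated (val x) y K.
Proof.
move=> /vn_boundedP bA eps0.
have [n [K nK]] := pairing_bounded alpha_dense e_cvg0 nu_admissible nu_lt0 eps0.
have [t t0 tA] := bA n; exists n, (t^-1 * K) => x Ax y yn.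
have xn : B n (t%:C%C *: val x).
  by apply: (tA x Ax) => l; rewrite normc_scale.
have xyK : dominated (t%:C%C *: val x) y K by exact: nK.
apply: dominated_unscale t0 xyK.
Qed.

Lemma bounded_pairing (A : set V) (y : Y) : vn_bounded A ->
  exists2 M, 0 < M & forall x, A x -> nc (pairing (val x) (val y)) <= M.
Proof.
move=> bA; have [eps eps0 yS] := set_mem (valP y).
have [n [K nK]] := bounded_dominated bA eps0.
have [t t0 ty] := @Snu_ball_absorb _ _ alpha e _ n yS.
exists (`|t^-1 * K| + 1) => [|x Ax]; first by rewrite ltr_wpDl.
have yn : Snu_ball (mu eps) alpha e n (t%:C%C *: val y).
  by apply: ty => l; rewrite normc_scale.
apply: (@le_trans _ _ (t^-1 * K)); last first.
  by apply: le_trans (ler_norm _) _; rewrite lerDl.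
apply/pairing_le/dominatedC.
apply: dominated_unscale t0 (dominatedC (nK x Ax _ yn)).
Qed.

Lemma pairing_dual (c : R[i]) (x : V) (y z : Y) :
  pairing (val x) (val (c *: y + z)) =
  c^* * pairing (val x) (val y) + pairing (val x) (val z).
Proof.
have [K yK] := dominated_dual alpha_dense e_cvg0 nu_admissible nu_lt0 x y.
have [K' zK] := dominated_dual alpha_dense e_cvg0 nu_admissible nu_lt0 x z.
exact: pairing_antilinear yK zK.
Qed.

Lemma pairing_dual0 (x : V) : pairing (val x) (val (0 : Y)) = 0.
Proof.
have := pairing_dual 1 x 0 0.
rewrite scaler0 addr0 rmorph1 mul1r => /eqP.
by rewrite -subr_eq0 opprD addrA subrr sub0r oppr_eq0 => /eqP.
Qed.

Lemma pairing_dualD (x : V) (y z : Y) : pairing (val x) (val (y + z)) =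
  pairing (val x) (val y) + pairing (val x) (val z).
Proof. by rewrite -[y]scale1r pairing_dual rmorph1 mul1r scale1r. Qed.

Lemma pairing_dualZ (c : R[i]) (x : V) (y : Y) :
  pairing (val x) (val (c *: y)) = c^* * pairing (val x) (val y).
Proof. by rewrite -[c *: y]addr0 pairing_dual pairing_dual0 addr0. Qed.

Lemma nbhs_normc (c : R[i]^o) (s : R) : 0 < s ->
  nbhs c [set c' | nc (c - c') < s].
Proof. by move=> s0; have /cvg_normcP := @cvg_id _ (nbhs c); exact. Qed.

Lemma strong_vector_topology : vector_topology (strong_topology nu alpha e).
Proof.
split=> -[].
  move=> y y' U /nbhs_strongP[A bA [r r0 AU]].
  have r20 : 0 < r / 2 by rewrite divr_gt0.
  pose W (y : Y) := [set z : Y | forall x, A x ->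
    nc (pairing (val x) (val y) - pairing (val x) (val z)) < r / 2].
  exists (W y, W y').
    by split; apply/nbhs_strongP; exists A => //; exists (r / 2).
  move=> [z z'] /= [Wz Wz']; apply: AU => x Ax /=.
  rewrite !pairing_dualD opprD addrACA (splitr r).
  apply: le_lt_trans (le_normcD _ _) _.
  by apply: ltrD; [exact: Wz|exact: Wz'].
move=> c y U /nbhs_strongP[A bA [r r0 AU]].
have r20 : 0 < r / 2 by rewrite divr_gt0.
have [M M0 AM] := bounded_pairing y bA.
have c1 : 0 < nc c + 1 by rewrite ltr_wpDl ?normc_ge0.
(* The difference is split into [(c - c')^* * p] and [c'^* * (p - q)]: the bound [r / 2 / M] handles
   the first part, and 1 gives [nc c' <= nc c + 1] for the second. *)
pose s := Num.min 1 (r / 2 / M).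
have s0 : 0 < s by rewrite lt_min ltr01 divr_gt0.
pose W := [set z : Y | forall x, A x ->
  nc (pairing (val x) (val y) - pairing (val x) (val z)) < r / 2 / (nc c + 1)].
exists ([set c' | nc (c - c') < s], W).
  split; first exact: nbhs_normc.
  by apply/nbhs_strongP; exists A => //; exists (r / 2 / (nc c + 1)) => //;
    rewrite divr_gt0.
move=> [c' z] /= [cc' Wz]; apply: AU => x Ax /=.
rewrite !pairing_dualZ.
set p := pairing _ (val y); set q := pairing _ (val z).
have -> : c^* * p - c'^* * q = (c - c')^* * p + c'^* * (p - q).
  by rewrite rmorphB/= mulrBl mulrBr addrA subrK.
rewrite (splitr r); apply: le_lt_trans (le_normcD _ _) _.
apply: ler_ltD; rewrite Normc.normcM normc_conj.
  apply: (@le_trans _ _ (r / 2 / M * M)); last by rewrite divfK ?gt_eqF.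
  apply: ler_pM; rewrite ?normc_ge0//; last exact: AM.
  by apply/ltW/(lt_le_trans cc'); rewrite ge_min lexx orbT.
have c'c : nc c' <= nc c + 1.
  rewrite -[c'](subrK c) addrC; apply: le_trans (le_normcD _ _) _.
  by rewrite lerD2l normcB; apply/ltW/(lt_le_trans cc'); rewrite ge_min lexx.
apply: le_lt_trans (ler_wpM2r (normc_ge0 _) c'c) _.
by rewrite -ltr_pdivlMl// mulrC; exact: Wz.
Qed.

(** A bounded set pairs with some ball of the step space within one constant [K]; shrinking the ball
    by the factor [s] brings this below [r]. *)
Lemma dual_incl_continuous (eps : {posnum R}) :
  continuous (@dual_incl R nu alpha e eps : _ -> T).
Proof.
move=> z U /nbhs_strongP[A bA [r r0 AU]].
have [n [K nK]] := bounded_dominated bA (gt0 eps).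
pose s := (`|K| + 1) / r.
have s0 : 0 < s by rewrite divr_gt0// ltr_wpDl.
have [m hm] := @Snu_ball_scale _ (mu eps%:num) alpha e s n.
apply/nbhs_SnuP; exists m => z' zz'; apply: AU => x Ax.
have -> : pairing (val x) (val (dual_incl z)) -
    pairing (val x) (val (dual_incl z')) =
    - pairing (val x) (val (dual_incl z' - dual_incl z)).
  rewrite -(scaleN1r (dual_incl z)) pairing_dualD pairing_dualZ.
  by rewrite rmorphN1 mulN1r opprB.
rewrite normcN.
have wn : Snu_ball (mu eps%:num) alpha e n (s%:C%C *: (val z' - val z)).
  by apply: hm zz' => l; rewrite normc_scale.
have dom : dominated (val x) (val (dual_incl z' - dual_incl z)) (s^-1 * K).
  apply/dominatedC.
  apply: dominated_unscale s0 (dominatedC (nK x Ax _ wn)).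
apply: le_lt_trans (pairing_le dom) _.
rewrite ltr_pdivrMl// /s divfK ?gt_eqF//.
by apply: le_lt_trans (ler_norm _) _; rewrite ltrDl.
Qed.

End strong_topology.

(** * The Banach-Dieudonne argument *)

Definition close_head (R : realType) (J : nat) (r : R) (w z : Omega R) : Prop :=
  forall l, (tag l < J)%N -> nc (w l - z l) < r.

Lemma near_forall_in (T : Type) (I : eqType) (F : set_system T) (FF : Filter F)
    (s : seq I) (P : I -> set T) :
  (forall i, F (P i)) -> F [set x | forall i, i \in s -> P i x].
Proof.
move=> FP; elim: s => [|i s IH]; first by apply: filterS filterT => x _ i.
apply: filterS (filterI (FP i) IH) => x [Pi Ps] j.
by rewrite inE => /predU1P[->//|]; exact: Ps.
Qed.

(** Tychonoff's theorem for the real and imaginary parts. The cluster property is phrased with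
    [close_head], the basic neighbourhoods of coordinatewise convergence. *)
Lemma bounded_cluster (R : realType) (c : Lambda -> R)
    (F : set_system (Omega R)) (FF : ProperFilter F) :
  F [set w | forall l, nc (w l) <= c l] ->
  exists w, forall J r A, 0 < r -> F A -> exists2 z, A z & close_head J r w z.
Proof.
move=> Fc.
pose Phi (w : Omega R) : prod_topology (fun _ : Lambda * bool => R) :=
  fun i => if i.2 then complex.Re (w i.1) else complex.Im (w i.1).
pose C := [set f : prod_topology (fun _ : Lambda * bool => R) |
  forall i, [set` `[- c i.1, c i.1]] (f i)].
have compC : compact C.
  exact: (@tychonoff (Lambda * bool)%type (fun=> R)
    (fun i => [set` `[- c i.1, c i.1]]) (fun i => @segment_compact _ _ _)).
have FC : (Phi @ F) C.
  apply: (@filterS _ F _ _ _ _ Fc) => w wc [l b].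
  rewrite /= in_itv/= -ler_norml.
  by case: b; apply: le_trans (wc l); [exact: normr_Re_le|exact: normr_Im_le].
have [f [_ clf]] := compC _ _ FC.
exists (fun l => Complex (f (l, true)) (f (l, false))) => J r A r0 FA.
have r20 : 0 < r / 2 by rewrite divr_gt0.
pose s := [seq (l, b) | l <- levels J, b <- [:: true; false]].
have : nbhs f [set g | forall i, i \in s -> `|f i - g i| < r / 2].
  apply: near_forall_in => i.
  have fi : nbhs (proj i f) (ball (f i) (r / 2)) by exact: nbhsx_ballx.
  have h := @proj_continuous _ (fun _ : Lambda * bool => R) i f _ fi.
  apply: (@filterS _ (nbhs f) _ _ _ _ h) => g.
  by rewrite -ball_normE.
have : (Phi @ F) (Phi @` A).
  by apply: (@filterS _ F _ _ _ _ FA) => w Aw; exists w.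
move=> /clf/[apply] -[_ [[z Az <-] zf]]; exists z => // l lJ.
have ls b : (l, b) \in s.
  by apply: allpairs_f; rewrite ?mem_levels//; case: b.
apply: le_lt_trans (normc_le_ReIm _) _; rewrite (splitr r).
apply: ltrD.
  by have := zf _ (ls true); rewrite /Phi/=; case: (z l).
by have := zf _ (ls false); rewrite /Phi/=; case: (z l).
Qed.

(** * Closedness and compactness of polars for coordinatewise convergence *)

Section finite_pairing.
Context {R : realType}.
Implicit Types x w z : Omega R.

Lemma finitely_supported_dominated x w : finitely_supported x ->
  exists K, dominated x w K.
Proof.
move=> [J xJ]; exists (\sum_(l <- levels J) nc (x l) * nc (w l)) => s us.
have [J' sJ'] := sub_levels s.
have fge0 l : 0 <= nc (x l) * nc (w l) by rewrite mulr_ge0 ?normc_ge0.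
apply: (@le_trans _ _ (\sum_(l <- levels (maxn J J')) nc (x l) * nc (w l))).
  apply: ler_sum_uniq_sub => //; first exact: levels_uniq.
  by move=> l /sJ'; rewrite !mem_levels => lJ'; rewrite leq_max lJ' orbT.
rewrite (big_uniq_support (s := levels J))//; try exact: levels_uniq.
  by move=> l; rewrite !mem_levels leq_max => ->.
move=> l; rewrite mem_levels => lJ.
by rewrite -xJ /truncate (negbTE lJ) Normc.normc0 mul0r.
Qed.

Lemma pairing_finite_linear (c : R[i]) x w z : finitely_supported x ->
  pairing x (c *: w + z) = c^* * pairing x w + pairing x z.
Proof.
move=> xf; have [K wK] := finitely_supported_dominated w xf.
have [K' zK] := finitely_supported_dominated z xf.
exact: pairing_antilinear wK zK.
Qed.

Lemma pairing_finite_continuous x r : finitely_supported x -> 0 < r ->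
  exists J, exists2 d, 0 < d & forall w z, close_head J d w z ->
    nc (pairing x w) <= nc (pairing x z) + r.
Proof.
move=> xf r0; have [J xJ] := xf.
pose S := \sum_(l <- levels J) nc (x l); have S0 : 0 <= S.
  by apply: sumr_ge0 => l _; exact: normc_ge0.
exists J, (r / (S + 1)); first by rewrite divr_gt0// ltr_wpDl.
move=> w z wz.
have -> : w = 1 *: (w - z) + z by rewrite scale1r subrK.
rewrite pairing_finite_linear// rmorph1 mul1r addrC.
apply: le_trans (le_normcD _ _) _; rewrite lerD2l (pairing_finite _ xJ).
apply: (@le_trans _ _ (\sum_(l <- levels J) nc (pairing_terms x (w - z) l))).
  rewrite /head_pairing; elim/big_rec2 : _ => [|l u v _ uv].
    by rewrite Normc.normc0.
  by apply: le_trans (le_normcD _ _) _; rewrite lerD2l.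
apply: (@le_trans _ _ (\sum_(l <- levels J) nc (x l) * (r / (S + 1)))).
  rewrite !big_seq; apply: ler_sum => l; rewrite mem_levels => /wz/ltW h.
  by rewrite normc_pairing_terms ler_wpM2l ?normc_ge0.
rewrite -mulr_suml -/S mulrCA -[leRHS]mulr1 ler_pM2l//.
by rewrite ler_pdivrMr ?ltr_wpDl// mul1r lerDl.
Qed.

(** Pairing with a finitely supported sequence is continuous in finitely many coordinates, so a
    cluster point inherits each bound; the member of the filter may depend on [x]. *)
Lemma polar_cluster (D : set (Omega R)) (F : set_system (Omega R)) w :
  D `<=` @finitely_supported R ->
  (forall J r A, 0 < r -> F A -> exists2 z, A z & close_head J r w z) ->
  (forall x, D x -> F [set z | nc (pairing x z) <= 1]) -> polar D w.
Proof.
move=> Dfin wF DF x Dx; apply/ler_addgt0Pr => r r0.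
have [J [d d0 xJ]] := pairing_finite_continuous (Dfin _ Dx) r0.
have [z zx /xJ wz] := wF J d _ d0 (DF x Dx).
by apply: le_trans wz _; rewrite lerD2r.
Qed.

(** Halving keeps the difference of two elements in the polar, where the uniform count bounds
    hold. *)
Lemma polar_midpoint (D : set (Omega R)) w z : D `<=` @finitely_supported R ->
  polar D w -> polar D z -> polar D (2^-1 *: (w - z)).
Proof.
move=> Dfin wD zD x Dx; have xf := Dfin _ Dx.
have -> : 2^-1 *: (w - z) = 2^-1 *: w + ((- 2^-1) *: z + 0).
  by rewrite addr0 scalerBr scaleNr.
rewrite !pairing_finite_linear//.
have -> : pairing x 0 = 0.
  have := pairing_finite_linear 1 0 0 xf.
  rewrite scaler0 addr0 rmorph1 mul1r => /eqP.
  by rewrite -subr_eq0 opprD addrA subrr sub0r oppr_eq0 => /eqP.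
rewrite addr0; apply: le_trans (le_normcD _ _) _.
rewrite !Normc.normcM !normc_conj normcN.
rewrite normc_inv2.
rewrite -mulrDr ler_pdivrMl// mulr1 [leRHS](_ : 2 = 1 + 1)//.
by apply: lerD; [exact: wD|exact: zD].
Qed.

(* [T'] exists because the polar of [D'] is compact for coordinatewise
   convergence. *)
Lemma polar_extend (D D' : set (Omega R)) (T : seq (Omega R))
    (O : set (Omega R)) :
  D `<=` @finitely_supported R -> D' `<=` @finitely_supported R ->
  {in T, forall x, finitely_supported x} ->
  (forall l, exists2 t : R, 0 < t & D' (t%:C%C *: delta l)) ->
  (forall w, polar D' w -> O w -> exists J, exists2 r, 0 < r &
    forall z, polar D' z -> close_head J r w z -> O z) ->
  (polar D `&` polar [set` T]) `<=` O ->
  exists2 T', [set` T'] `<=` D & (polar D' `&` polar [set` T ++ T']) `<=` O.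
Proof.
move=> Dfin D'fin Tfin D'abs O_open DTO; apply: contrapT => noT.
(* The failures of the choice [T']. If every choice fails, these sets generate a proper filter. Its
   cluster point lies in the polars of [D], [D'] and [T], hence in [O], and openness then puts a
   failure into [O]. *)
pose W (T' : seq (Omega R)) := [set w | [/\ polar D' w, polar [set` T ++ T'] w
  & ~ O w]].
pose F := filter_from [set T' : seq (Omega R) | [set` T'] `<=` D] W.
have FF : ProperFilter F.
  apply: filter_from_proper.
    apply: filter_from_filter; first by exists [::].
    move=> T1 T2 /= T1D T2D; exists (T1 ++ T2).
      by move=> x /=; rewrite mem_cat => /orP[/T1D|/T2D].
    move=> w [wD' wT wO]; split; split => // x /=; rewrite mem_cat => xT;
      apply: wT; rewrite /= !mem_cat; case/orP: xT => ->; rewrite ?orbT//.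
  move=> T' T'D; apply: contrapT => W0; apply: noT; exists T' => //.
  move=> w [wD' wT]; apply: contrapT => wO; apply: W0; exists w.
  by split.
have FD' : F (polar D') by exists [::] => // w [].
have /choice[c hc] := fun l => let: ex_intro2 t t0 Dt := D'abs l in
  ex_intro (fun t => 0 < t /\ D' (t%:C%C *: delta l)) t (conj t0 Dt).
have [w wF] : exists w, forall J r A, 0 < r -> F A ->
    exists2 z, A z & close_head J r w z.
  (* [D'] contains a positive multiple of each unit sequence, so its polar is bounded in every
     coordinate. *)
  apply: (@bounded_cluster _ (fun l => (c l)^-1)).
  apply: filterS FD' => w wD' l; have [c0 /wD'] := hc l.
  rewrite pairing_scale_delta.
  rewrite Normc.normcM normc_real normc_conj gtr0_norm//.
  by rewrite -ler_pdivlMl// mulr1.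
have wD' : polar D' w.
  apply: polar_cluster D'fin wF _ => x D'x.
  by apply: filterS FD' => z; exact.
have Ow : O w.
  apply: DTO; split; first apply: polar_cluster Dfin wF _ => x Dx.
    (* Each single [x] of [D] is itself an admissible choice, so its bound holds on a member of the
       filter. *)
    exists [:: x]; first by move=> y /=; rewrite inE => /eqP ->.
    by move=> z [_ zT _]; apply: zT; rewrite /= mem_cat inE eqxx orbT.
  apply: (@polar_cluster [set` T] F) wF _ => [x /Tfin//|x xT].
  by exists [::] => // z [_ zT _]; apply: zT; rewrite /= mem_cat xT.
have [J [r r0 wr]] := O_open w wD' Ow.
have FW : F (W [::]) by exists [::].
have [z [zD' _ nOz] wz] := wF J r _ r0 FW.
exact/nOz/wr.
Qed.

End finite_pairing.

Lemma finite_absorb (R : realType) (nu : R -> \bar R) alpha e n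
    (T : seq (Omega R)) : {in T, forall x, finitely_supported x} ->
  exists2 t : R, 0 < t & forall x, x \in T -> forall z,
    (forall l, nc (z l) <= t * nc (x l)) -> Snu_ball nu alpha e n z.
Proof.
elim: T => [|x T IH] Tfin; first by exists 1.
have [|t t0 tT] := IH.
  by move=> y yT; apply: Tfin; rewrite inE yT orbT.
have /(@finite_Snu _ nu)/(@Snu_ball_absorb _ _ alpha e _ n)[s s0 sx] :=
  Tfin x (mem_head _ _).
exists (Num.min s t); first by rewrite lt_min s0.
move=> y; rewrite inE => /orP[/eqP ->|yT] z zy; [apply: sx => l|
  apply: (tT y yT) => l]; apply: le_trans (zy l) _;
  by rewrite ler_wpM2r ?normc_ge0// ge_min lexx ?orbT.
Qed.

Section banach_dieudonne.
Context {R : realType} (nu : R -> \bar R) (alpha : nat -> R).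
Variable e : nat -> {posnum R}.
Local Notation V := (Snu nu alpha e).
Local Notation B := (Snu_ball nu alpha e).
Local Notation fin := (@finitely_supported R).

Lemma banach_dieudonne (O : set (Omega R)) : O 0 ->
  (forall k w, polar (fin `&` B k) w -> O w -> exists J, exists2 r, 0 < r &
    forall z, polar (fin `&` B k) z -> close_head J r w z -> O z) ->
  exists2 A : set V, vn_bounded A & forall k,
    polar (fin `&` B k) `&` polar [set val x | x in A] `<=` O.
Proof.
move=> O0 O_open.
(* The polar of [D 0] is {0}, which starts the construction; every later step
   [k.+1] only adds elements of [B k], whence the boundedness of the union. *)
pose D k := if k is k'.+1 then fin `&` B k' else fin.
have Dfin k : D k `<=` fin by case: k => [|k] // x [].
have delta_fin c l : fin (c *: delta l).
  exists (tag l).+1; apply/funext => l'; rewrite /truncate scale_deltaE.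
  by case: ltnP => //; have [->|//] := eqVneq l' l; rewrite ltnn.
pose P k (T : seq (Omega R)) := {in T, forall x, fin x} /\
  polar (D k) `&` polar [set` T] `<=` O.
have /choice[g hg] : forall kT : nat * seq (Omega R), exists T', P kT.1 kT.2 ->
    [set` T'] `<=` D kT.1 /\ P kT.1.+1 (kT.2 ++ T').
  move=> [k T] /=; have [[Tfin TO]|nP] := pselect (P k T); last by exists [::].
  have [||T' T'D T'O] := @polar_extend R (D k) (D k.+1) T O (Dfin k)
      (Dfin k.+1) Tfin _ _ TO.
  - move=> l; have dS : Snu_set nu (delta l : Omega R).
      by apply: finite_Snu; rewrite -[delta l]scale1r; exact: delta_fin.
    have [t t0 ht] := @Snu_ball_absorb _ _ alpha e _ k dS.
    exists t => //; split; first exact: delta_fin.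
    by apply: ht => l'; rewrite normc_scale.
  - exact: O_open.
  exists T' => _; split => //; split => // x; rewrite mem_cat.
  by case/orP => [/Tfin//|/T'D/Dfin].
(* The state carries its own stage number, on which the extension [g] depends. *)
pose T k := (iter k (fun kT => (kT.1.+1, kT.2 ++ g kT)) (0%N, [::])).2.
have TE k : iter k (fun kT => (kT.1.+1, kT.2 ++ g kT)) (0%N, [::]) = (k, T k).
  rewrite [LHS]surjective_pairing; congr pair.
  by elim: k => //= k ->.
have TS k : T k.+1 = T k ++ g (k, T k) by rewrite /T iterS TE.
have PT k : P k (T k).
  elim: k => [|k /(hg (k, T k))[_]]; last by rewrite TS.
  split=> // w [wD _]; suff -> : w = 0 by [].
  apply/funext => l; apply/eqP; have [//|wl] := eqVneq (w l) 0.
  have w0 : 0 < nc (w l).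
    rewrite lt_neqAle normc_ge0 andbT eq_sym; apply: contra_neq wl.
    exact: Normc.eq0_normc.
  (* This multiple of the unit sequence pairs with [w] to modulus 2, against the bound 1. *)
  have := wD _ (delta_fin (2 / nc (w l))%:C%C l).
  rewrite pairing_scale_delta Normc.normcM normc_real normc_conj.
  rewrite gtr0_norm ?divr_gt0// divfK ?gt_eqF//.
  by rewrite leNgt ltr1n.
have T_mono k n : (k <= n)%N -> {subset T k <= T n}.
  move=> kn x; rewrite -(subnK kn); elim: (n - k)%N => // m IH xk.
  by rewrite addSn TS mem_cat IH.
(* Apart from the finite list [T n.+1], everything ever added lies in [B n]; this gives the
   boundedness of the union. *)
have T_tail n k x : x \in T k -> x \in T n.+1 \/ B n x.
  elim: k => [//|k IH]; rewrite TS mem_cat => /orP[/IH//|xg].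
  have [kn|nk] := leqP k n.
    by left; apply: (T_mono k.+1); rewrite ?ltnS// TS mem_cat xg orbT.
  right; have /= [gD _] := hg (k, T k) (PT k).
  case: k nk {IH} xg gD => [//|k] nk xg /(_ x xg)[_].
  exact: le_Snu_ball.
exists [set x | exists k, val x \in T k].
  apply/vn_boundedP => n.
  have [t t0 tT] := @finite_absorb _ nu alpha e n _ (PT n.+1).1.
  exists (Num.min t 1); first by rewrite lt_min t0 ltr01.
  move=> x [k /(T_tail n)[xT|xB]] z zx.
    apply: (tT _ xT) => l; apply: le_trans (zx l) _.
    by rewrite ler_wpM2r ?normc_ge0// ge_min lexx.
  apply: Snu_ball_dominated xB => l; apply: le_trans (zx l) _.
  by rewrite ler_piMl ?normc_ge0// ge_min lexx orbT.
(* Stage [k.+1] is the right one, since [D k.+1] is formed with [B k]. *)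
move=> k w [wk wA]; apply: (PT k.+1).2; split => //= x xT.
have xS : x \in Snu_pred nu by apply/mem_set/finite_Snu/((PT k.+1).1 x xT).
by apply: wA; exists (exist _ x xS) => //; exists k.+1.
Qed.

End banach_dieudonne.

(** * Comparison of the strong topology with any topology making the inclusions continuous *)

Section final_topology.
Context {R : realType} (nu : R -> \bar R) (alpha : nat -> R).
Variables (e eps : nat -> {posnum R}).
Hypothesis alpha_dense : dense (range alpha).
Hypothesis e_cvg0 : (e m)%:num @[m --> \oo] --> (0 : R).
Hypothesis eps_cvg0 : (eps m)%:num @[m --> \oo] --> (0 : R).
Hypothesis nu_admissible : admissible nu.
Hypothesis nu_lt0 : exists a, (nu a < 0)%E.
Variable sigma : Topological (dual_seqs nu).
Hypothesis sigma_cont : forall m,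
  continuous (@dual_incl R nu alpha e (eps m) : _ -> Topological.Pack sigma).

Local Notation B := (Snu_ball nu alpha e).
Local Notation fin := (@finitely_supported R).
Local Notation mu := (shift_profile (dual_profile nu)).

(** For [eps m] small, one step space contains both [y0] and the polar, and on the polar
    coordinatewise convergence implies convergence in it. Continuity of the inclusion into [sigma]
    then makes the trace of [U] coordinatewise open. *)
Lemma polar_incl_continuous (U : set (Topological.Pack sigma))
    (y0 z : dual_seqs nu) k :
  open U -> polar (fin `&` B k) (val z) -> U (y0 + z) ->
  exists J, exists2 r, 0 < r & forall w, polar (fin `&` B k) w ->
    close_head J r (val z) w ->
    exists2 z' : dual_seqs nu, val z' = w & U (y0 + z').
Proof.
move=> U_open zk Uz.
have [d d0 hd] := @polar_count_bounded _ _ alpha e k nu_admissible.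
have [a a0 y0S] := set_mem (valP y0).
have ad0 : 0 < Num.min a d by rewrite lt_min a0.
move/cvgrPdist_lt : eps_cvg0 => /(_ _ ad0)[m _ /(_ m (leqnn m))].
rewrite sub0r normrN gtr0_norm// lt_min => /andP[ma md].
have {}hd := hd (eps m)%:num; rewrite gt0 (ltW md) in hd.
have {}hd := hd isT.
have {a a0 ad0 ma}y0S : Snu_set (mu (eps m)%:num) (val y0).
  apply: le_Snu_set y0S => b; apply: shift_dual_profile_homo; exact: ltW.
pose mk w (wk : polar (fin `&` B k) w) : Snu (mu (eps m)%:num) alpha e :=
  exist _ (val y0 + w) (mem_set (Snu_setD y0S (count_bounded_Snu hd wk))).
have Uv : U (dual_incl (mk _ zk)).
  by rewrite (_ : dual_incl _ = y0 + z)//; exact: val_inj.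
have /nbhs_SnuP[n hn] := sigma_cont (open_nbhs_nbhs (conj U_open Uv)).
have [n' hn'] := @Snu_ball_scale _ (mu (eps m)%:num) alpha e 2 n.
have [J hJ] := @count_bounded_ball _ _ alpha e _ n' hd.
exists J, J.+1%:R^-1 => [|w wk zw]; first by rewrite invr_gt0 ltr0n.
have wD : w \in dual_pred nu.
  by apply/Snu_dual_set/(count_bounded_Snu hd wk).
exists (exist _ w wD) => //.
rewrite (_ : y0 + _ = dual_incl (mk w wk)); last exact: val_inj.
apply: hn => /=.
rewrite opprD addrACA subrr add0r.
(* The count bounds apply to half the difference, which stays in the polar; the ball [n'] was chosen
   to absorb the factor 2. *)
apply: (hn' (2^-1 *: (w - val z))) => [l|].
  by rewrite Normc.normcM normc_inv2 mulrA mulfV ?mul1r.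
apply: hJ; first by apply: polar_midpoint => // x [].
move=> l lJ; rewrite Normc.normcM normc_inv2.
apply: le_lt_trans (zw l lJ); rewrite [leRHS]normcB.
by rewrite ler_piMl ?normc_ge0// invf_le1// ler1n.
Qed.

(** [banach_dieudonne] is applied to the translate of [U] by [- y0]. For [z] close to [y0] on the
    bounded set [A], the difference [z - y0] lies in the polar of [A], and by continuity of its form
    also in the polar of some ball. *)
Lemma strong_nbhs (U : set (Topological.Pack sigma)) (y0 : dual_seqs nu) :
  open U -> U y0 ->
  nbhs (y0 : Topological.Pack (strong_topology nu alpha e)) U.
Proof.
move=> U_open Uy0; apply/nbhs_strongP.
have [|k w wk [z zw Uz]|A bA AU] := @banach_dieudonne R nu alpha e
  [set w | exists2 z : dual_seqs nu, val z = w & U (y0 + z)].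
- by exists 0; rewrite ?addr0.
- by rewrite -zw in wk *; exact: polar_incl_continuous.
exists A => //; exists 1 => // z zA.
have pairing_sub (x : Snu nu alpha e) :
    nc (pairing (val x) (val (z - y0))) < 1 \/ ~ A x.
  have [Ax|] := pselect (A x); last by right.
  left; rewrite -(scaleN1r y0) pairing_dualD// pairing_dualZ//.
  by rewrite rmorphN1 mulN1r -normcN opprB; exact: zA.
have [a a0 wS] := set_mem (valP (z - y0)).
have [n [K nK]] :=
  dual_seq_bounded alpha_dense e_cvg0 nu_admissible nu_lt0 a0 wS.
pose s := `|K| + 1; have s0 : 0 < s by rewrite ltr_wpDl.
have [k hk] := @Snu_ball_scale _ nu alpha e s n.
suff /AU[z' /val_inj ->] : (polar (fin `&` B k) `&`
    polar [set val x | x in A]) (val (z - y0)) by rewrite addrC subrK.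
split; last first.
  by move=> _ [x Ax <-]; have [/ltW|] := pairing_sub x.
move=> x [_ xk]; have xn : B n (s%:C%C *: x).
  by apply: hk xk => l; rewrite normc_scale.
have xK : dominated x (val (z - y0)) (s^-1 * K).
  apply: dominated_unscale s0 (nK _ xn).
apply: le_trans (pairing_le xK) _.
rewrite ler_pdivrMl// mulr1; apply: le_trans (ler_norm _) _.
by rewrite /s lerDl.
Qed.

End final_topology.

Theorem theorem4 (R : realType) (nu : R -> \bar R)
    (alpha : nat -> R) (e : nat -> {posnum R}) (eps : nat -> {posnum R}) :
  dense (range alpha) ->
  nonincreasing_seq (fun m => (e m)%:num : R) ->
  (e m)%:num @[m --> \oo] --> (0 : R) ->
  nonincreasing_seq (fun m => (eps m)%:num : R) ->
  (eps m)%:num @[m --> \oo] --> (0 : R) ->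
  admissible nu ->
  alpha_min nu \is a fin_num ->
  p0 nu = 1%E ->
  [/\ forall (x : Snu nu alpha e) (y : dual_seqs nu),
        cvg (summability.partial_sum (pairing_terms (val x) (val y))
             @ summability.totally),
      set_bij [set: dual_seqs nu]
        (topological_dual (Snu nu alpha e))
        (@dual_form R nu alpha e)
    & finest_vector_topology
        (fun m => @dual_incl R nu alpha e (eps m))
        (strong_topology nu alpha e)].
Proof.
move=> alpha_dense _ e0 _ eps0 nuA amin _.
(* To the left of the finite [alpha_min] the profile takes no nonnegative value, so it is -oo
   there. *)
have nu_lt0 : exists a, (nu a < 0)%E.
  exists (fine (alpha_min nu) - 1).
  have [->|[v nuv v0]] := admissible_val (fine (alpha_min nu) - 1) nuA.
    exact: ltNyr.
  have : (alpha_min nu <= (fine (alpha_min nu) - 1)%:E)%E.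
    by apply: ereal_inf_lbound; exists (fine (alpha_min nu) - 1) => //=;
      rewrite nuv lee_fin.
  by rewrite -[X in (X <= _)%E]fineK// lee_fin lerBrDr gerDl ler10.
split.
- move=> x y; have [K xyK] := dominated_dual alpha_dense e0 nuA nu_lt0 x y.
  by apply/cvg_ex; exists (pairing (val x) (val y)); exact: pairing_cvg xyK.
- split.
  + move=> y _; split.
      exact: dual_form_linear.
    exact: dual_form_continuous.
  + by move=> y y' _ _; exact: dual_form_inj.
  + move=> f [f_lin f_cont].
    pose g : {linear Snu nu alpha e -> R[i]^o} := HB.pack f
      (GRing.isLinear.Build _ _ _ _ _ f_lin).
    by have [y yf] := dual_form_surj alpha_dense e0 nuA nu_lt0 (f := g) f_cont;
      exists y.
split.
  split; first exact: strong_vector_topology.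
  by move=> m; exact: dual_incl_continuous.
move=> sigma [_ sigma_cont] U U_open; rewrite openE => y0 Uy0.
exact: (strong_nbhs alpha_dense e0 eps0 nuA nu_lt0 sigma_cont U_open Uy0).
Qed.
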